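(* Let $L,N\in\mathbb{N}$, let $T_2,\ldots,T_N$ be invertible complex $L\times L$ matrices and $V_1,\ldots,V_N$ self-adjoint complex $L\times L$ matrices, and put $T_1=T_{N+1}=\mathbf{1}$. For $z\in\mathbb{C}$ let $$\mathcal{T}^z_n=\begin{pmatrix}(z\mathbf{1}-V_n)T_n^{-1} & -T_n^*\\ T_n^{-1} & \mathbf{0}\end{pmatrix},\quad n=1,\ldots,N,\qquad \mathcal{T}^z_N\cdots\mathcal{T}^z_1=\begin{pmatrix}A^z_N & B^z_N\\ C^z_N & D^z_N\end{pmatrix},$$ with $L\times L$ blocks $A^z_N,B^z_N,C^z_N,D^z_N$. For a unitary $U\in\mathrm{U}(L)$ without eigenvalue $-1$, let $Z$ be the unique self-adjoint matrix with $U=(-Z-\imath\mathbf{1})(-Z+\imath\mathbf{1})^{-1}$, let $H^N_{\mathbf{0},Z}$ be the $NL\times NL$ block tridiagonal matrix with diagonal blocks $V_1,V_2,\ldots,V_{N-1},V_N-Z$, superdiagonal blocks $T_2,\ldots,T_N$ and subdiagonal blocks $T_2^*,\ldots,T_N^*$, and let $G^z_N(\mathbf{1},U)=\pi_1^*(H^N_{\mathbf{0},Z}-z\mathbf{1})^{-1}\pi_1$, where $\pi_1:\mathbb{C}^L\to\mathbb{C}^{NL}$ is the isometric embedding onto the first block. Let $dU$ be the normalized Haar measure on $\mathrm{U}(L)$. Then for $\Im m(z)>0$, $$\int dU\,G^z_N(\mathbf{1},U)=\left[A^z_N+\imath C^z_N\right]^{-1}\left[B^z_N+\imath D^z_N\right]=\left[(B^{\overline{z}}_N)^*+\imath(D^{\overline{z}}_N)^*\right]\left[(A^{\overline{z}}_N)^*+\imath(C^{\overline{z}}_N)^*\right]^{-1}.$$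 Moreover, for $E\in\mathbb{R}$, with $\Im m(X)=\frac{1}{2\imath}(X-X^* )$ for any square matrix $X$ and the limit taken with $\Re e(z)=E$, $$\lim_{\Im m(z)\downarrow 0}\int dU\,\Im m\big(G^z_N(\mathbf{1},U)\big)=\left[(A^E_N)^*A^E_N+(C^E_N)^*C^E_N\right]^{-1}.$$
   Context: The set of unitaries with eigenvalue $-1$ has Haar measure zero, so $G^z_N(\mathbf{1},U)$ is defined for $dU$-almost every $U$; $\mathbf{1}$ in the first argument indicates the Dirichlet left boundary condition (the first diagonal block is $V_1$ unmodified).
   Formalization: The exceptional set is corrected: the equation U=(-Z-i)(-Z+i)^{-1} is solvable for Z exactly when U has no eigenvalue 1 (not -1; U=1 admits no Z), so Z=i(U-1)^{-1}(U+1) is used off that Haar-null set; the integrals are unaffected. *)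

(* Defs.v *)
From HB Require Import structures.
From mathcomp Require Import all_boot all_order all_algebra.
From mathcomp Require Import all_classical all_reals all_analysis.
From mathcomp Require Import complex.
Import Order.TTheory GRing.Theory Num.Theory.
Import numFieldNormedType.Exports.

Set Implicit Arguments.
Unset Strict Implicit.
Unset Printing Implicit Defensive.

Local Open Scope ring_scope.
Local Open Scope complex_scope.
Local Open Scope classical_set_scope.

Definition MxT (R : realType) (L : nat) : Type := 'M[R[i]]_L.
HB.instance Definition _ R L := Choice.on (MxT R L).
HB.instance Definition _ R L := isPointed.Build (MxT R L) (0 : 'M[R[i]]_L).

Section Defs.
Variable R : realType.
Variable L : nat.
Local Notation C := (R[i]).
Local Notation MT := 'M[C]_L.

Definition adjmx (X : MT) : MT := (map_mx Num.conj X)^T.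

Definition ImMx (X : MT) : MT := (2%:R * 'i)^-1 *: (X - adjmx X).

Definition unitary_mx (U : MT) : bool := adjmx U *m U == 1%:M.

(* Z with U = (-Z - i)(-Z + i)^{-1}, i.e. Z = i (U - 1)^{-1} (U + 1) *)
Definition cayley_Z (U : MT) : MT := 'i *: (invmx (U - 1%:M) *m (U + 1%:M)).

Definition Tt (T : nat -> MT) (n : nat) : MT := if n == 1%N then 1%:M else T n.

(* The block tridiagonal matrix H^N_{0,Z} (1-based blocks n = i+1) *)
Definition Hmat (N : nat) (T V : nat -> MT) (Z : MT) : 'M[C]_(\sum_(i < N) L) :=
  @mxblock C N N (fun _ => L) (fun _ => L)
    (fun (i j : 'I_N) =>
       if i == j then V i.+1 - (if i.+1 == N then Z else 0)
       else if j == i.+1 :> nat then Tt T i.+2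
       else if i == j.+1 :> nat then adjmx (Tt T i.+1)
       else 0).

Definition Gfun (N : nat) (hN : (0 < N)%N) (T V : nat -> MT) (z : C) (U : MT) : MT :=
  @submxblock C N N (fun _ => L) (fun _ => L)
    (invmx (Hmat N T V (cayley_Z U) - z%:M)) (Ordinal hN) (Ordinal hN).

Definition transfer1 (T V : nat -> MT) (z : C) (n : nat) : 'M[C]_(L + L) :=
  block_mx ((z%:M - V n) *m invmx (Tt T n)) (- adjmx (Tt T n)) (invmx (Tt T n)) 0.

Fixpoint transfer (T V : nat -> MT) (z : C) (n : nat) : 'M[C]_(L + L) :=
  match n with
  | 0 => 1%:M
  | n'.+1 => transfer1 T V z n'.+1 *m transfer T V z n'
  end.

Definition Ablk T V z N : MT := ulsubmx (transfer T V z N).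
Definition Bblk T V z N : MT := ursubmx (transfer T V z N).
Definition Cblk T V z N : MT := dlsubmx (transfer T V z N).
Definition Dblk T V z N : MT := drsubmx (transfer T V z N).

(* Borel sigma-algebra on complex L x L matrices: generated by the real and
   imaginary parts of the entries *)
Definition mx_gen : set (set (MxT R L)) :=
  [set S | exists (i j : 'I_L) (A : set R), measurable A /\
     (S = (fun X : MxT R L => complex.Re (X i j)) @^-1` A \/
      S = (fun X : MxT R L => complex.Im (X i j)) @^-1` A)].

Local Notation MxSpace := (g_sigma_algebraType mx_gen).

Definition is_haar (P : probability MxSpace R) : Prop :=
  P [set U : MxSpace | unitary_mx U] = 1%E /\
  forall W : MT, unitary_mx W ->
    forall A : set MxSpace, measurable A ->
      P ((fun U : MxSpace => (W *m U : MxSpace)) @^-1` A) = P A.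

Definition mx_integral (P : probability MxSpace R) (F : MxSpace -> MT) : MT :=
  \matrix_(i, j) Complex (Rintegral P setT (fun U => complex.Re (F U i j)))
                         (Rintegral P setT (fun U => complex.Im (F U i j))).

End Defs.

Notation MxSpace R L := (g_sigma_algebraType (@mx_gen R L)).

(* Main.v *)
(** Write [W = U^*], [a = A + i C], [a' = A - i C], [b = B + i D], [b' = B - i D]. Solving the
    block recursion with transfer matrices gives [G = (A + Z C)^-1 (B + Z D)], and multiplying both
    factors by [1 - W], where [(1 - W) Z = i (1 + W)], turns this into
    [G = (a - W a')^-1 (b - W b')]. The flux identity [|a x|^2 - |a' x|^2 = 4 Im z sum_n |C_n x|^2],
    whose term [n = 1] is [|x|^2], makes [a] invertible and [S = a' a^-1] a strict contraction, so
    [G = a^-1 b + a^-1 (sum_k (W S)^k W) (S b - b')] with uniformly small remainders. Every term of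
    the sum has positive degree in [U^*], so it integrates to 0 by invariance under [U |-> t U] for
    unimodular scalars [t]. The second formula and the limit follow from the symplectic identity
    [M(z) J M(conj z)^* = J], which for real [z] yields [b a^* - a b^* = 2 i]. *)

Require Import Defs.
From HB Require Import structures.
From mathcomp Require Import all_boot all_order all_algebra.
From mathcomp Require Import all_classical all_reals all_analysis.
From mathcomp Require Import measurable_realfun complex ring lra.
Import Order.TTheory GRing.Theory Num.Theory.
Import numFieldNormedType.Exports.
Local Open Scope ring_scope.
Local Open Scope complex_scope.
Local Open Scope classical_set_scope.

(** * Adjoints, the Frobenius norm and contractions *)

(** The measure [P] lives on all matrices and only charges the unitary ones, while [invmx] and the
    integral return default values where they make no sense. So bounds are asked on unitaries only,
    and [Gfun], which carries a default value at unitaries with eigenvalue 1, is replaced almost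
    everywhere by its Neumann form, which is bounded on all unitaries. That the exceptional set is
    null is proved by rotating it with many distinct scalars. The squared Frobenius norm [frob] is
    used throughout: being a trace, it turns Gram identities into norm identities, and it is
    invariant under left multiplication by unitaries; the price is a weighted triangle inequality.
    The strict contraction degenerates as Im z tends to 0, so the limit is never exchanged with the
    integral. It is taken in the closed form, where the one delicate point, invertibility of [a] at
    real energy, comes from the Wronskian [2 i] and not from the flux. *)

Section Adjoint.
Context {R : realType} {L : nat}.
Implicit Types X Y : 'M[R[i]]_L.

Lemma adjmxE X i j : adjmx X i j = (X j i)^*%C.
Proof. by rewrite !mxE. Qed.

Lemma adjmxD X Y : adjmx (X + Y) = adjmx X + adjmx Y.
Proof. by apply/matrixP => i j; rewrite !mxE rmorphD. Qed.

Lemma adjmxN X : adjmx (- X) = - adjmx X.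
Proof. by apply/matrixP => i j; rewrite !mxE rmorphN. Qed.

Lemma adjmxB X Y : adjmx (X - Y) = adjmx X - adjmx Y.
Proof. by rewrite adjmxD adjmxN. Qed.

Lemma adjmxZ c X : adjmx (c *: X) = c^*%C *: adjmx X.
Proof. by apply/matrixP => i j; rewrite !mxE rmorphM. Qed.

Lemma adjmxM X Y : adjmx (X *m Y) = adjmx Y *m adjmx X.
Proof. by rewrite /adjmx map_mxM trmx_mul. Qed.

Lemma adjmxK X : adjmx (adjmx X) = X.
Proof. by apply/matrixP => i j; rewrite !adjmxE conjcK. Qed.

Lemma adjmx0 : adjmx (0 : 'M[R[i]]_L) = 0.
Proof. by apply/matrixP => i j; rewrite !mxE rmorph0. Qed.

Lemma adjmx_scalar (c : R[i]) : adjmx (c%:M : 'M[R[i]]_L) = (c^*%C)%:M.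
Proof. by rewrite /adjmx map_scalar_mx tr_scalar_mx. Qed.

Lemma adjmx1 : adjmx (1%:M : 'M[R[i]]_L) = 1%:M.
Proof. by rewrite adjmx_scalar rmorph1. Qed.

Lemma unitmx_adj X : (adjmx X \in unitmx) = (X \in unitmx).
Proof. by rewrite unitmx_tr map_unitmx. Qed.

Lemma adjmx_inv X : adjmx (invmx X) = invmx (adjmx X).
Proof. by rewrite /adjmx map_invmx trmx_inv. Qed.

Lemma unitary_mxV X : unitary_mx X -> X *m adjmx X = 1%:M.
Proof. by move/eqP/mulmx1C. Qed.

Lemma unitary_adjmx X : unitary_mx X -> unitary_mx (adjmx X).
Proof. by move=> /unitary_mxV h; rewrite /unitary_mx adjmxK h. Qed.

End Adjoint.

(** The test matrix is [cokermx A], a square matrix that [A] kills and whose vanishing means full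
    rank. Testing on square [X] rather than on columns lets [frob] serve directly. *)
Lemma unitmx_ker {F : fieldType} {n : nat} (A : 'M[F]_n) :
  (forall X : 'M[F]_n, A *m X = 0 -> X = 0) -> A \in unitmx.
Proof.
move=> h; rewrite -row_full_unit /row_full eqn_leq rank_leq_col /=.
by rewrite -subn_eq0 -mxrank_coker (h _ (mulmx_coker A)) mxrank0.
Qed.

Section Frobenius.
Context {R : realType} {L : nat}.
Implicit Types X Y : 'M[R[i]]_L.

(** Real-valued, unlike the norm of [R[i]], whose values lie in [R[i]]. *)
Definition sqnorm (x : R[i]) : R := complex.Re x ^+ 2 + complex.Im x ^+ 2.

Definition frob X : R := \sum_i \sum_j sqnorm (X i j).

Lemma sqnorm_ge0 x : 0 <= sqnorm x.
Proof. by rewrite addr_ge0 ?sqr_ge0. Qed.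

Lemma sqnorm_eq0 x : (sqnorm x == 0) = (x == 0).
Proof.
by case: x => a b; rewrite /sqnorm paddr_eq0 ?sqr_ge0 //= !sqrf_eq0 eq_complex.
Qed.

Lemma sqnormE x : (sqnorm x)%:C = x^*%C * x.
Proof. by case: x => a b; simpc; rewrite /sqnorm /=; congr (_ +i* _); ring. Qed.

Lemma sqnormM x y : sqnorm (x * y) = sqnorm x * sqnorm y.
Proof. by case: x y => a b [c d]; rewrite /sqnorm /=; ring. Qed.

Lemma frobE X : (frob X)%:C = \tr (adjmx X *m X).
Proof.
rewrite /frob exchange_big rmorph_sum /=; apply: eq_bigr => i _.
rewrite rmorph_sum mxE; apply: eq_bigr => j _.
by rewrite adjmxE -sqnormE.
Qed.

Lemma frob_ge0 X : 0 <= frob X.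
Proof. by apply: sumr_ge0 => i _; apply: sumr_ge0 => j _; apply: sqnorm_ge0. Qed.

Lemma sqnorm_le_frob X i j : sqnorm (X i j) <= frob X.
Proof.
rewrite /frob (bigD1 i) //= (bigD1 j) //= -addrA lerDl addr_ge0 //.
  by apply: sumr_ge0 => *; apply: sqnorm_ge0.
by apply: sumr_ge0 => *; apply: sumr_ge0 => *; apply: sqnorm_ge0.
Qed.

Lemma frob_eq0 X : frob X = 0 -> X = 0.
Proof.
move=> h; apply/matrixP => i j; rewrite mxE; apply/eqP.
by rewrite -sqnorm_eq0 eq_le sqnorm_ge0 -[X in _ <= X]h sqnorm_le_frob.
Qed.

Lemma frob0 : frob (0 : 'M[R[i]]_L) = 0.
Proof.
by apply: big1 => i _; apply: big1 => j _; rewrite mxE /sqnorm expr0n addr0.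
Qed.

Lemma frob_unitary U X : unitary_mx U -> frob (U *m X) = frob X.
Proof.
move=> /eqP hU; apply: (@complexI R).
by rewrite !frobE adjmxM mulmxA -(mulmxA (adjmx X)) hU mulmx1.
Qed.

(** The triangle inequality for squared norms, in Young's form: the defect is
    [e^-1 * (x - e * y) ^+ 2]. A small [e] keeps the factor of [Y] near 1 at the expense of that of
    [X]. *)
Lemma frobD e X Y : 0 < e ->
  frob (X + Y) <= (1 + e^-1) * frob X + (1 + e) * frob Y.
Proof.
move=> e0; have ie0 : 0 < e^-1 by rewrite invr_gt0.
have real_ineq (x y : R) : (x + y) ^+ 2 <= (1 + e^-1) * x ^+ 2 + (1 + e) * y ^+ 2.
  rewrite -subr_ge0; suff -> : (1 + e^-1) * x ^+ 2 + (1 + e) * y ^+ 2 - (x + y) ^+ 2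
    = e^-1 * (x - e * y) ^+ 2 by rewrite mulr_ge0 ?sqr_ge0 // ltW.
  by field; rewrite gt_eqF.
rewrite /frob !mulr_sumr -big_split /=; apply: ler_sum => i _.
rewrite !mulr_sumr -big_split /=; apply: ler_sum => j _; rewrite mxE.
case: (X i j) (Y i j) => a b [c d]; rewrite /sqnorm /=.
by have := real_ineq a c; have := real_ineq b d; lra.
Qed.

Lemma frob_scale c X : frob (c *: X) = sqnorm c * frob X.
Proof.
rewrite /frob mulr_sumr; apply: eq_bigr => i _; rewrite mulr_sumr.
by apply: eq_bigr => j _; rewrite mxE sqnormM.
Qed.

Lemma frob_delta i j X : frob (delta_mx i j *m X) <= frob X.
Proof.
have dE k l : (delta_mx i j *m X) k l = if k == i then X j l else 0.
  rewrite mxE (bigD1 j) //= big1 => [|m /negPf mj]; rewrite mxE ?mj ?andbF ?mul0r //.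
  by rewrite eqxx andbT addr0; case: (k == i); rewrite ?mul1r ?mul0r.
rewrite /frob (bigD1 i) //= [X in _ + X]big1 ?addr0 => [|k /negPf ki].
  under eq_bigr do rewrite dE eqxx.
  rewrite [leRHS](bigD1 j) //= lerDl.
  by apply: sumr_ge0 => *; apply: sumr_ge0 => *; apply: sqnorm_ge0.
by apply: big1 => l _; rewrite dE ki /sqnorm expr0n addr0.
Qed.

(** Matrices with such a bound are closed under sums, and multiples of elementary matrices have one
    because they only move and scale a row. Only the existence of the constant matters. *)
Lemma frob_mulmx_bounded A :
  exists2 c, 0 < c & forall X, frob (A *m X) <= c * frob X.
Proof.
pose bounded (B : 'M[R[i]]_L) :=
  exists2 c, 0 < c & forall X, frob (B *m X) <= c * frob X.
have bounded0 : bounded 0 by exists 1 => // X; rewrite mul0mx frob0 mul1r frob_ge0.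
have boundedD B C : bounded B -> bounded C -> bounded (B + C).
  move=> [c c0 hB] [d d0 hC].
  exists (2 * (c + d)) => [|X]; first by rewrite mulr_gt0 ?addr_gt0.
  rewrite mulmxDl; apply: le_trans (frobD _ _ _ (ltr01 : 0 < 1 :> R)) _.
  by rewrite invr1; have := hB X; have := hC X; lra.
rewrite (matrix_sum_delta A); apply: (big_ind bounded bounded0 boundedD) => i _.
apply: (big_ind bounded bounded0 boundedD) => j _; exists (sqnorm (A i j) + 1) => [|X].
  by rewrite ltr_wpDl ?sqnorm_ge0.
rewrite -scalemxAl frob_scale [leRHS]mulrDl mul1r.
apply: le_trans (ler_wpM2l (sqnorm_ge0 _) (frob_delta _ _ _)) _.
by rewrite lerDl frob_ge0.
Qed.

End Frobenius.

Section Contraction.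
Context {R : realType} {L : nat}.
Variables (S : 'M[R[i]]_L) (s : R).
Hypotheses (s0 : 0 <= s) (s1 : s < 1).
Hypothesis contrS : forall X, frob (S *m X) <= s * frob X.

(** Quantitative invertibility of [1 - W S] with a constant independent of [W]; this uniformity
    later bounds all Neumann remainders at once. *)
Lemma contraction_bounded : exists2 c, 0 < c &
  forall W X : 'M[R[i]]_L, unitary_mx W ->
    frob X <= c * frob ((1%:M - W *m S) *m X).
Proof.
(* With this choice [(1 + e) * s] is at most [(1 + s) / 2 = 1 - e], the gap being
   [(1 - s) ^+ 2 / 2]. Splitting [X] into [X - W S X] and [W S X] then leaves a share [e * frob X]
   to be bounded by the first part. *)
pose e := (1 - s) / 2.
have e0 : 0 < e by rewrite divr_gt0 ?subr_gt0.
have ie0 : 0 < e^-1 by rewrite invr_gt0.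
have h : (1 + e) * s <= (1 + s) / 2.
  have : 0 <= s * (1 - s) by rewrite mulr_ge0 // subr_ge0 ltW.
  have : 0 <= (1 - s) * (1 - s) by rewrite mulr_ge0 // subr_ge0 ltW.
  by rewrite /e; nra.
exists ((1 + e^-1) / e) => [|W X uW]; first by rewrite divr_gt0 // addr_gt0.
rewrite mulrAC ler_pdivlMr // mulmxBl mul1mx.
have := frobD e (X - W *m S *m X) (W *m S *m X) e0.
rewrite subrK -(mulmxA W) (frob_unitary _ _ uW).
have : (1 + e) * frob (S *m X) <= (1 + s) / 2 * frob X.
  apply: le_trans (ler_wpM2r (frob_ge0 X) h); rewrite -mulrA ler_wpM2l //.
  by rewrite addr_ge0 // ltW.
by rewrite /e; lra.
Qed.

Lemma contraction_unit W : unitary_mx W -> 1%:M - W *m S \in unitmx.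
Proof.
move=> uW; apply: unitmx_ker => X X0; have [c _ /(_ W X uW)] := contraction_bounded.
by rewrite X0 frob0 mulr0 => h; apply: frob_eq0; apply/eqP; rewrite eq_le h frob_ge0.
Qed.

Lemma frob_contraction_iter W X n : unitary_mx W ->
  frob (iter n (mulmx (W *m S)) X) <= s ^+ n * frob X.
Proof.
move=> uW; elim: n => [|n IH] /=; first by rewrite expr0 mul1r.
rewrite -mulmxA (frob_unitary _ _ uW) exprS -mulrA.
exact: le_trans (contrS _) (ler_wpM2l s0 IH).
Qed.

End Contraction.

(** * Transfer matrices *)

Lemma submxblock1 {F : nzRingType} {N : nat} {p_ : 'I_N -> nat} (i j : 'I_N)
    (k : 'I_(p_ i)) (l : 'I_(p_ j)) :
  submxblock (1%:M : 'M[F]_(\sum_i p_ i)) i j k l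
    = ((i == j) && (k == l :> nat))%:R.
Proof.
rewrite !mxE /tagnat.Rank (inj_eq tagnat.rank_inj) -tag_eqE /tag_eq /=.
case: eqP => //= ij; case: _ / ij l => l.
by rewrite tagged_asE.
Qed.

Lemma submxrowM {F : nzRingType} {N m n : nat} {q_ : 'I_N -> nat} (A : 'M[F]_(m, n))
    (B : 'M[F]_(n, \sum_i q_ i)) j :
  submxrow (A *m B) j = A *m submxrow B j.
Proof.
by apply/matrixP => k l; rewrite !mxE; apply: eq_bigr => ? _; rewrite !mxE.
Qed.

Section Transfer.
Context {R : realType} {L : nat}.
Variables (T V : nat -> 'M[R[i]]_L) (N : nat).
Hypothesis T_unit : forall n, (2 <= n <= N)%N -> T n \in unitmx.
Hypothesis V_sa : forall n, (1 <= n <= N)%N -> adjmx (V n) = V n.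

Local Notation A z n := (Ablk T V z n).
Local Notation B z n := (Bblk T V z n).
Local Notation C z n := (Cblk T V z n).
Local Notation D z n := (Dblk T V z n).

Lemma Tt_unit n : (n < N)%N -> Tt T n.+1 \in unitmx.
Proof. by rewrite /Tt; case: n => [|n] nN /=; [exact: unitmx1 | apply: T_unit]. Qed.

Lemma transferE z n :
  transfer T V z n = block_mx (A z n) (B z n) (C z n) (D z n).
Proof. by rewrite submxK. Qed.

Lemma transfer_blocks0 z : [/\ A z 0 = 1%:M, B z 0 = 0, C z 0 = 0 & D z 0 = 1%:M].
Proof.
rewrite /Ablk /Bblk /Cblk /Dblk /= scalar_mx_block.
by rewrite block_mxKul block_mxKur block_mxKdl block_mxKdr.
Qed.

(** The new [A] and [B] are written through the new [C] and [D], so that each column reads as a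
    three-term recursion. *)
Lemma transfer_blocksS z n :
  [/\ C z n.+1 = invmx (Tt T n.+1) *m A z n,
      D z n.+1 = invmx (Tt T n.+1) *m B z n,
      A z n.+1 = (z%:M - V n.+1) *m C z n.+1 - adjmx (Tt T n.+1) *m C z n &
      B z n.+1 = (z%:M - V n.+1) *m D z n.+1 - adjmx (Tt T n.+1) *m D z n].
Proof.
have : block_mx (A z n.+1) (B z n.+1) (C z n.+1) (D z n.+1)
    = transfer1 T V z n.+1 *m block_mx (A z n) (B z n) (C z n) (D z n).
  by rewrite -!transferE.
rewrite /transfer1 mulmx_block => /eq_block_mx[-> -> -> ->].
by rewrite !mul0mx !addr0 !mulmxA !mulNmx.
Qed.

Definition symp : 'M[R[i]]_(L + L) := block_mx 0 (- 1%:M) 1%:M 0.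

Lemma adjmx_block (a b c d : 'M[R[i]]_L) :
  adjmx (block_mx a b c d) = block_mx (adjmx a) (adjmx c) (adjmx b) (adjmx d).
Proof. by rewrite /adjmx map_block_mx tr_block_mx. Qed.

(** Taking the adjoint at the conjugate parameter makes the two occurrences of [z] cancel, so the
    relation holds off the real axis as well; the [V] terms cancel by self-adjointness. *)
Lemma transfer1_symp z n : (n < N)%N ->
  transfer1 T V z n.+1 *m symp *m adjmx (transfer1 T V z^*%C n.+1) = symp.
Proof.
move=> nN; have tu := Tt_unit n nN.
rewrite /transfer1 /symp adjmx_block !mulmx_block adjmxM adjmxB adjmx_scalar.
rewrite conjcK V_sa // adjmxN adjmxK adjmx0 adjmx_inv.
rewrite !(mul0mx, mulmx0, mulmx1, mulmxN, mulNmx, opprK, add0r, addr0, oppr0).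
rewrite mulmxA mulmxKV // mulmxV ?unitmx_adj // mul1mx addNr.
by rewrite mulVmx.
Qed.

Lemma transfer_symp z n : (n <= N)%N ->
  transfer T V z n *m symp *m adjmx (transfer T V z^*%C n) = symp.
Proof.
elim: n => [|n IH] nN /=; first by rewrite adjmx1 mul1mx mulmx1.
rewrite adjmxM !mulmxA -(mulmxA (transfer1 _ _ _ _)) -(mulmxA (transfer1 _ _ _ _)).
by rewrite IH ?transfer1_symp // ltnW.
Qed.

Lemma transfer_symp_blocks z n : (n <= N)%N ->
  [/\ B z n *m adjmx (A z^*%C n) = A z n *m adjmx (B z^*%C n),
      A z n *m adjmx (D z^*%C n) - B z n *m adjmx (C z^*%C n) = 1%:M,
      D z n *m adjmx (A z^*%C n) - C z n *m adjmx (B z^*%C n) = 1%:M &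
      D z n *m adjmx (C z^*%C n) = C z n *m adjmx (D z^*%C n)].
Proof.
move=> nN; have := transfer_symp z n nN.
rewrite !transferE /symp adjmx_block !mulmx_block => /eq_block_mx[].
rewrite !(mul0mx, mulmx0, mulmx1, mulmxN, mulNmx, opprK, add0r, addr0, oppr0).
move=> /eqP; rewrite subr_eq0 => /eqP h1 h2 h3 /eqP; rewrite subr_eq0 => /eqP h4.
by split=> //; rewrite -[RHS]opprK -h2 opprB addrC.
Qed.

(** A discrete Green identity. As [A z n] is [T_{n+1} C_{n+1}], the hopping terms at step [n + 1]
    reproduce the flux at [n], the self-adjoint [V] drops out, and the step adds
    [(conj z - z) C^* C]. *)
Lemma transfer_flux z n : (n <= N)%N ->
  adjmx (A z n) *m C z n - adjmx (C z n) *m A z n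
    = (z^*%C - z) *: \sum_(1 <= k < n.+1) adjmx (C z k) *m C z k.
Proof.
elim: n => [|n IH] nN.
  have [_ _ -> _] := transfer_blocks0 z.
  by rewrite big_geq // adjmx0 mulmx0 mul0mx subrr scaler0.
rewrite big_nat_recr //= scalerDr -IH 1?ltnW //.
have [CE _ AE _] := transfer_blocksS z n.
have TC : Tt T n.+1 *m C z n.+1 = A z n by rewrite CE mulmxA mulmxV ?mul1mx ?Tt_unit.
rewrite AE adjmxB !adjmxM adjmxB adjmx_scalar V_sa // adjmxK -TC adjmxM.
rewrite !(mulmxBl, mulmxBr) !(mul_mx_scalar, mul_scalar_mx) -!scalemxAl -!scalemxAr.
by rewrite !mulmxA scalerBl; apply/matrixP => i j; rewrite !mxE; ring.
Qed.

End Transfer.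

(** The hypotheses on [c] describe exactly ['i] and [- 'i], so that both signs share one proof. *)
Lemma adjmx_combM {R : realType} {L : nat} (c : R[i]) (X Y : 'M[R[i]]_L) :
  c^*%C = - c -> c * c = -1 ->
  adjmx (X + c *: Y) *m (X + c *: Y)
    = adjmx X *m X + adjmx Y *m Y + c *: (adjmx X *m Y - adjmx Y *m X).
Proof.
move=> cJ cc; rewrite adjmxD adjmxZ cJ !(mulmxDl, mulmxDr) -!scalemxAl -!scalemxAr.
rewrite scalerA mulNr cc opprK scale1r scalerBr scaleNr.
by apply/matrixP => i j; rewrite !mxE; ring.
Qed.

Lemma conj_i {R : realType} : ('i : R[i])^*%C = - 'i.
Proof. by simpc. Qed.

Lemma mul_ii {R : realType} : 'i * 'i = -1 :> R[i].
Proof. by rewrite -expr2 sqr_i. Qed.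

Lemma conj_Ni {R : realType} : (- 'i : R[i])^*%C = - - 'i.
Proof. by simpc. Qed.

Lemma gram_diff {R : realType} {L : nat} (c d : R[i]) (X Y S : 'M[R[i]]_L) :
  c^*%C = - c -> c * c = -1 -> adjmx X *m Y - adjmx Y *m X = d *: S ->
  adjmx (X + c *: Y) *m (X + c *: Y)
    = adjmx (X - c *: Y) *m (X - c *: Y) + (2 * c * d) *: S.
Proof.
move=> cJ cc h; have NcJ : (- c)^*%C = - - c by rewrite -[in RHS]cJ -rmorphN.
have NcNc : - c * - c = -1 by rewrite mulrNN.
rewrite -(scaleNr c) (adjmx_combM c _ _ cJ cc) (adjmx_combM (- c) _ _ NcJ NcNc) h.
rewrite !scalerA -!addrA -scalerDl.
by congr (_ + (_ + _ *: _)); rewrite mulNr -mulrA mulr_natl mulr2n addKr.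
Qed.

(** * Wronskian identities and the boundary combinations of the transfer blocks *)

Section Wronskian.
Context {R : realType} {L : nat}.
Implicit Types P Q X Y A B C D : 'M[R[i]]_L.

Section Comb.
Variables (c : R[i]) (A B C D A1 B1 C1 D1 : 'M[R[i]]_L).
Hypotheses (cc : c * c = -1) (BA : B *m A1 = A *m B1).
Hypotheses (AD : A *m D1 - B *m C1 = 1%:M) (DA : D *m A1 - C *m B1 = 1%:M).
Hypothesis (DC : D *m C1 = C *m D1).

Let BC : B *m C1 = A *m D1 - 1%:M. Proof. by rewrite -AD subKr. Qed.
Let DA' : D *m A1 = C *m B1 + 1%:M. Proof. by rewrite -DA addrC subrK. Qed.

(** [A1], ..., [D1] stand for the adjoint blocks at the conjugate of [z]. Equal signs of [c] on both
    sides give the exchange behind the second formula; the opposite signs in the next lemma leave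
    the constant [2 * c]. *)
Lemma wronskian_comb :
  (B + c *: D) *m (A1 + c *: C1) = (A + c *: C) *m (B1 + c *: D1).
Proof.
rewrite !(mulmxDl, mulmxDr) -!scalemxAl -!scalemxAr !scalerA cc BA DC BC DA'.
by apply/matrixP => i j; rewrite !mxE; ring.
Qed.

Lemma wronskian_comb_conj :
  (B + c *: D) *m (A1 + - c *: C1) - (A + c *: C) *m (B1 + - c *: D1) = (2 * c)%:M.
Proof.
rewrite !(mulmxDl, mulmxDr) -!scalemxAl -!scalemxAr !scalerA mulrN cc BA DC BC DA'.
by rewrite -scalemx1; apply/matrixP => i j; rewrite !mxE; ring.
Qed.

End Comb.

(** If [adjmx P] kills [X], then [X^* P = 0] too, and sandwiching the identity between [X^*] and [X]
    leaves [c X^* X = 0]. This gives invertibility at real energies, where the coercive estimate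
    degenerates. *)
Lemma unit_wronskian c P Q : c != 0 ->
  Q *m adjmx P - P *m adjmx Q = c%:M -> P \in unitmx.
Proof.
move=> c0 W; rewrite -unitmx_adj; apply: unitmx_ker => X PX.
have XP : adjmx X *m P = 0 by rewrite -[LHS]adjmxK adjmxM adjmxK PX adjmx0.
have := congr1 (fun M => adjmx X *m M *m X) W.
rewrite mulmxBr mulmxBl !mulmxA XP !mul0mx subr0 -!mulmxA PX !mulmx0 => /esym/eqP.
rewrite mul_scalar_mx -scalemxAr scaler_eq0 (negPf c0) /= => /eqP h.
by apply: frob_eq0; apply: (@complexI R); rewrite frobE h mxtrace0.
Qed.

Lemma two_i_neq0 : 2 * 'i != 0 :> R[i].
Proof. by rewrite mulf_neq0 ?pnatr_eq0 // eq_complex /= oner_eq0 andbF. Qed.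

(** Multiplying by [P] on the left and [P^*] on the right gives
    [2i P Im(P^-1 Q) P^* = Q P^* - P Q^* = 2i]. *)
Lemma ImMx_wronskian P Q :
  Q *m adjmx P - P *m adjmx Q = (2 * 'i)%:M ->
  ImMx (invmx P *m Q) = invmx (adjmx P *m P).
Proof.
move=> W; have uP := unit_wronskian _ _ _ two_i_neq0 W.
have uP' : adjmx P \in unitmx by rewrite unitmx_adj.
rewrite /ImMx adjmxM adjmx_inv.
apply: (can_inj (mulKmx uP)); apply: (can_inj (mulmxK uP')).
rewrite -scalemxAr mulmxBr -scalemxAl mulmxBl !mulmxA mulmxV // mul1mx mulmxKV //.
rewrite W scale_scalar_mx mulVf ?two_i_neq0 //.
have uPP : adjmx P *m P \in unitmx by rewrite unitmx_mul uP uP'.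
apply: (can_inj (mulKmx uP')); apply: (can_inj (mulmxK uP)).
by rewrite mulmx1 !mulmxA mulmxV // mul1mx.
Qed.

End Wronskian.

Section Boundary.
Context {R : realType} {L : nat}.
Variables (T V : nat -> 'M[R[i]]_L) (N : nat).
Hypothesis N_gt0 : (0 < N)%N.
Hypothesis T_unit : forall n, (2 <= n <= N)%N -> T n \in unitmx.
Hypothesis V_sa : forall n, (1 <= n <= N)%N -> adjmx (V n) = V n.

Local Notation A z n := (Ablk T V z n).
Local Notation B z n := (Bblk T V z n).
Local Notation C z n := (Cblk T V z n).
Local Notation D z n := (Dblk T V z n).
Local Notation a z := (A z N + 'i *: C z N).
Local Notation a' z := (A z N - 'i *: C z N).
Local Notation b z := (B z N + 'i *: D z N).
Local Notation b' z := (B z N - 'i *: D z N).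

(** The constant arises as [2 i (conj z - z) = 4 Im z]. *)
Lemma boundary_gram z :
  adjmx (a z) *m a z = adjmx (a' z) *m a' z
    + (4 * complex.Im z)%:C *: \sum_(1 <= k < N.+1) adjmx (C z k) *m C z k.
Proof.
rewrite (gram_diff _ _ _ _ _ conj_i mul_ii (transfer_flux T V N T_unit V_sa z N (leqnn N))).
have -> : 2 = (2 : R)%:C by rewrite rmorph_nat.
congr (_ + _ *: _); case: z => x y; simpc; congr (_ +i* _); rewrite /=; ring.
Qed.

Lemma frob_gram (P Q X : 'M[R[i]]_L) (c : R) (F : nat -> 'M[R[i]]_L) :
  adjmx P *m P = adjmx Q *m Q + c%:C *: \sum_(1 <= k < N.+1) adjmx (F k) *m F k ->
  frob (P *m X) = frob (Q *m X) + c * \sum_(1 <= k < N.+1) frob (F k *m X).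
Proof.
move=> h; apply: (@complexI R).
have frobM (Y : 'M[R[i]]_L) : (frob (Y *m X))%:C = \tr (adjmx X *m (adjmx Y *m Y) *m X).
  by rewrite frobE adjmxM !mulmxA.
have sumM : (\sum_(1 <= k < N.+1) frob (F k *m X))%:C
    = \tr (adjmx X *m (\sum_(1 <= k < N.+1) adjmx (F k) *m F k) *m X).
  rewrite rmorph_sum mulmx_sumr mulmx_suml raddf_sum.
  by apply: eq_bigr => k _; apply: frobM.
have rD (x y w : R) : (x + y * w)%:C = x%:C + y%:C * w%:C by rewrite rmorphD rmorphM.
rewrite rD sumM !frobM h mulmxDr mulmxDl mxtraceD.
by rewrite -scalemxAr -scalemxAl mxtraceZ.
Qed.

(** Of the flux sum only the term [k = 1] is kept: there [C] is the identity, because [A z 0 = 1]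
    and [T_1 = 1]. *)
Lemma boundary_coercive z X : 0 <= complex.Im z ->
  4 * complex.Im z * frob X + frob (a' z *m X) <= frob (a z *m X).
Proof.
move=> z0; rewrite (frob_gram _ _ X _ _ (boundary_gram z)) addrC lerD2l.
rewrite ler_wpM2l ?mulr_ge0 // big_ltn // -[leLHS]addr0 lerD //; last first.
  by apply: sumr_ge0 => *; apply: frob_ge0.
have [A0 _ _ _] := transfer_blocks0 T V z; have [-> _ _ _] := transfer_blocksS T V z 0.
by rewrite A0 mulmx1 /Tt /= invmx1 mul1mx.
Qed.

(** Below the real axis the flux changes sign and [a'] dominates [a]. This case matters because the
    factor inverted in the second formula is the adjoint of [a'] at the conjugate of [z]. *)
Lemma boundary_coercive_lower z X : complex.Im z <= 0 ->
  - (4 * complex.Im z) * frob X + frob (a z *m X) <= frob (a' z *m X).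
Proof.
move=> z0; rewrite (frob_gram _ _ X _ _ (boundary_gram z)).
rewrite addrCA -[leRHS]addr0 lerD2l -subr_ge0 sub0r mulNr opprD opprK subr_ge0.
rewrite ler_wnM2l ?mulr_ge0_le0 // big_ltn // -[leLHS]addr0 lerD //; last first.
  by apply: sumr_ge0 => *; apply: frob_ge0.
have [A0 _ _ _] := transfer_blocks0 T V z; have [-> _ _ _] := transfer_blocksS T V z 0.
by rewrite A0 mulmx1 /Tt /= invmx1 mul1mx.
Qed.

Lemma boundary_unit z : 0 < complex.Im z -> a z \in unitmx.
Proof.
move=> z0; apply: unitmx_ker => X X0; apply: frob_eq0; apply/eqP.
rewrite eq_le frob_ge0 andbT -(pmulr_rle0 _ (mulr_gt0 (ltr0n R 4) z0)).
have := boundary_coercive z X (ltW z0); rewrite X0 frob0; apply: le_trans.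
by rewrite lerDl frob_ge0.
Qed.

Lemma boundary_unit_lower z : complex.Im z < 0 -> a' z \in unitmx.
Proof.
move=> z0; have z1 : 0 < - (4 * complex.Im z) by rewrite oppr_gt0 pmulr_rlt0.
apply: unitmx_ker => X X0; apply: frob_eq0; apply/eqP.
rewrite eq_le frob_ge0 andbT -(pmulr_rle0 _ z1).
have := boundary_coercive_lower z X (ltW z0); rewrite X0 frob0; apply: le_trans.
by rewrite lerDl frob_ge0.
Qed.

Lemma boundary_contraction z : 0 < complex.Im z ->
  exists s : R, [/\ 0 <= s, s < 1 &
    forall X, frob (a' z *m invmx (a z) *m X) <= s * frob X].
Proof.
move=> z0; have [c c0 bc] := frob_mulmx_bounded (a z).
(* For [Y = a^-1 X], coercivity gains [k * frob Y], and [frob X <= d * frob Y] turns this into the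
   share [k / d] of [frob X]. The maximum with [k] keeps [1 - k / d] nonnegative. *)
pose k := 4 * complex.Im z; have k0 : 0 < k by rewrite mulr_gt0.
pose d := Num.max c k; have d0 : 0 < d by rewrite lt_max c0.
have kd : k / d <= 1 by rewrite ler_pdivrMr // mul1r le_max lexx orbT.
exists (1 - k / d); split; rewrite ?subr_ge0 ?ltrBlDr ?ltrDl ?divr_gt0 // => X.
set Y := invmx (a z) *m X.
have aY : a z *m Y = X by rewrite mulmxA mulmxV ?mul1mx ?boundary_unit.
rewrite -mulmxA -/Y; have := boundary_coercive z Y (ltW z0); rewrite aY -/k => h.
have /(_ Y) := bc; rewrite aY => h'.
have : frob X <= d * frob Y.
  by apply: le_trans h' _; rewrite ler_wpM2r ?frob_ge0 // le_max lexx.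
rewrite mulrC -ler_pdivrMr // => h''.
have : k * (frob X / d) <= k * frob Y by rewrite ler_wpM2l // ltW.
suff -> : (1 - k / d) * frob X = frob X - k * (frob X / d) by lra.
by rewrite mulrBl mul1r mulrA (mulrAC k).
Qed.

Lemma boundary_swap z :
  b z *m (adjmx (A z^*%C N) + 'i *: adjmx (C z^*%C N))
    = a z *m (adjmx (B z^*%C N) + 'i *: adjmx (D z^*%C N)).
Proof.
have [BA AD DA DC] := transfer_symp_blocks T V N T_unit V_sa z N (leqnn N).
exact: wronskian_comb mul_ii BA AD DA DC.
Qed.

Lemma boundary_adj_unit z : 0 < complex.Im z ->
  adjmx (A z^*%C N) + 'i *: adjmx (C z^*%C N) \in unitmx.
Proof.
move=> z0; have -> : adjmx (A z^*%C N) + 'i *: adjmx (C z^*%C N) = adjmx (a' z^*%C).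
  by rewrite -scaleNr adjmxD adjmxZ conj_Ni opprK.
by rewrite unitmx_adj boundary_unit_lower //; case: z z0 => x y; rewrite /= oppr_lt0.
Qed.

Section RealEnergy.
Variable E : R.

(** At real energy the flux vanishes, and with it the cross term between [A] and [C]. *)
Lemma boundary_real_gram :
  adjmx (a E%:C) *m a E%:C
    = adjmx (A E%:C N) *m A E%:C N + adjmx (C E%:C N) *m C E%:C N.
Proof.
rewrite (adjmx_combM 'i _ _ conj_i mul_ii).
rewrite (transfer_flux T V N T_unit V_sa E%:C N (leqnn N)) conjc_real subrr scale0r scaler0.
by rewrite addr0.
Qed.

Lemma boundary_real_wronskian :
  b E%:C *m adjmx (a E%:C) - a E%:C *m adjmx (b E%:C) = (2 * 'i)%:M.
Proof.
have := transfer_symp_blocks T V N T_unit V_sa E%:C N (leqnn N).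
rewrite conjc_real => -[BA AD DA DC].
rewrite !adjmxD !adjmxZ conj_i.
exact: wronskian_comb_conj mul_ii BA AD DA DC.
Qed.

Lemma ImMx_boundary_real :
  ImMx (invmx (a E%:C) *m b E%:C)
    = invmx (adjmx (A E%:C N) *m A E%:C N + adjmx (C E%:C N) *m C E%:C N).
Proof.
by rewrite (ImMx_wronskian _ _ boundary_real_wronskian) boundary_real_gram.
Qed.

End RealEnergy.

End Boundary.

(** * The resolvent of the block tridiagonal matrix *)

Lemma mulmx_comb {K : nzRingType} {m n q p : nat} (X Y : 'M[K]_(m, n))
    (c c' d d' : 'M[K]_(n, q)) (u v : 'M[K]_(q, p)) :
  (X *m c - Y *m c') *m u + (X *m d - Y *m d') *m v
    = X *m (c *m u + d *m v) - Y *m (c' *m u + d' *m v).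
Proof. by rewrite !mulmxBl !mulmxDr addrACA opprD !mulmxA. Qed.

Section Green.
Context {R : realType} {L : nat}.
Variables (T V : nat -> 'M[R[i]]_L) (N : nat).
Hypothesis N_gt0 : (0 < N)%N.
Hypothesis T_unit : forall n, (2 <= n <= N)%N -> T n \in unitmx.
Variables (z : R[i]) (Z : 'M[R[i]]_L).

Local Notation A n := (Ablk T V z n).
Local Notation B n := (Bblk T V z n).
Local Notation C n := (Cblk T V z n).
Local Notation D n := (Dblk T V z n).

(** Block rows of the eigenvalue equation, with a fictitious block [u 0] entering row 1 through
    [T_1^*]. The first conditional is the boundary term [Z], the second cuts off the block beyond
    [N]. *)
Definition three_term {p} (u : nat -> 'M[R[i]]_(L, p)) := forall n, (n < N)%N ->
  (V n.+1 - (if n.+1 == N then Z else 0)) *m u n.+1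
  + (if (n.+1 < N)%N then Tt T n.+2 *m u n.+2 else 0)
  + adjmx (Tt T n.+1) *m u n = z *: u n.+1.

Section Solution.
Context {p : nat} (u : nat -> 'M[R[i]]_(L, p)).
Hypothesis u_sol : three_term u.

(** The conditionals treat all rows together: in an interior row the right-hand side is the next
    [T u], in the last row it is [- Z u_N]. *)
Lemma transfer_step n : (n < N)%N ->
  A n *m u 1%N + B n *m u 0%N = Tt T n.+1 *m u n.+1 ->
  C n *m u 1%N + D n *m u 0%N = u n ->
  A n.+1 *m u 1%N + B n.+1 *m u 0%N
    = (if (n.+1 < N)%N then Tt T n.+2 *m u n.+2 else 0)
      - (if n.+1 == N then Z else 0) *m u n.+1
  /\ C n.+1 *m u 1%N + D n.+1 *m u 0%N = u n.+1.
Proof.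
move=> nN IA IC; have [CE DE AE BE] := transfer_blocksS T V z n.
have Cu : C n.+1 *m u 1%N + D n.+1 *m u 0%N = u n.+1.
  by rewrite CE DE -!mulmxA -mulmxDr IA mulmxA mulVmx ?mul1mx ?(Tt_unit _ N T_unit).
split; last exact: Cu.
rewrite AE BE mulmx_comb Cu IC mulmxBl mul_scalar_mx -(u_sol n nN) mulmxBl.
set t := if _ then _ else _; set s := _ *m u n.+1; set r := V _ *m _.
by apply/matrixP => i j; rewrite !mxE; ring.
Qed.

Lemma three_term_transfer n : (n < N)%N ->
  A n *m u 1%N + B n *m u 0%N = Tt T n.+1 *m u n.+1
  /\ C n *m u 1%N + D n *m u 0%N = u n.
Proof.
elim: n => [|n IH] nN.
  have [-> -> -> ->] := transfer_blocks0 T V z.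
  by rewrite /Tt /= !mul1mx !mul0mx addr0 add0r.
have n1N := ltnW nN; have [IA IC] := IH n1N.
by have [-> ->] := transfer_step n n1N IA IC; rewrite nN (ltn_eqF nN) mul0mx subr0.
Qed.

Lemma three_term_boundary :
  A N *m u 1%N + B N *m u 0%N = - (Z *m u N) /\ C N *m u 1%N + D N *m u 0%N = u N.
Proof.
have nN : (N.-1 < N)%N by rewrite ltn_predL.
have [IA IC] := three_term_transfer _ nN; have := transfer_step _ nN IA IC.
by rewrite (prednK N_gt0) ltnn eqxx sub0r.
Qed.

(** Adding [Z] times the second boundary equation to the first cancels [u N] and leaves a relation
    between [u 1] and [u 0] alone. *)
Lemma three_term_solution :
  (A N + Z *m C N) *m u 1%N = - ((B N + Z *m D N) *m u 0%N).
Proof.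
have [hA hC] := three_term_boundary.
apply/eqP; rewrite -addr_eq0 !mulmxDl addrACA hA -!mulmxA -mulmxDr hC.
by rewrite addNr.
Qed.

Lemma three_term_unique : u 0%N = 0 -> A N + Z *m C N \in unitmx ->
  forall n, (n <= N)%N -> u n = 0.
Proof.
move=> u0 hu; have u1 : u 1%N = 0.
  apply: (can_inj (mulKmx hu)); rewrite three_term_solution u0.
  by rewrite !mulmx0 oppr0.
move=> n; rewrite leq_eqVlt => /predU1P[->|nN].
  by have [_ <-] := three_term_boundary; rewrite u0 u1 !mulmx0 addr0.
by have [_ <-] := three_term_transfer n nN; rewrite u0 u1 !mulmx0 addr0.
Qed.

End Solution.

Local Notation NL := (\sum_(i < N) L)%N.
Local Notation H := (Hmat N T V Z).
Local Notation subcol := (@submxcol _ N (fun=> L) _).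

(** Index 0 holds [- y]: since [T_1 = 1], a source [y] in the first block row amounts to a
    fictitious neighbour of value [- y] and no source. *)
Definition blocks {p} (x : 'M[R[i]]_(NL, p)) (y : 'M[R[i]]_(L, p)) (k : nat) :=
  if k is k'.+1 then if insub k' is Some i then subcol x i else 0 else - y.

Lemma blocksE p x y (i : 'I_N) : @blocks p x y i.+1 = subcol x i.
Proof. by rewrite /= valK. Qed.

(** Picks the single nonzero term on a diagonal of the matrix; the test [k < N] produces the cut-off
    in the last row. *)
Lemma sum_ord_eq p (F : 'I_N -> 'M[R[i]]_(L, p)) (G : nat -> 'M[R[i]]_(L, p)) k :
  (forall j : 'I_N, F j = if j == k :> nat then G j else 0) ->
  \sum_j F j = if (k < N)%N then G k else 0.
Proof.
move=> FG; rewrite (eq_bigr _ (fun j _ => FG j)) -big_mkcond /=.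
case: ltnP => kN; first by rewrite (big_pred1 (Ordinal kN)) // => j; rewrite /= -val_eqE.
by apply: big1 => j /eqP jk; have := ltn_ord j; rewrite jk ltnNge kN.
Qed.

(** With source 0 the block [u 0] is 0, so the last summand vanishes in the first row, where the
    matrix has no subdiagonal block. *)
Lemma subcol_Hmat p (x : 'M[R[i]]_(NL, p)) (i : 'I_N) :
  let u := blocks x 0 in
  subcol (H *m x) i = (V i.+1 - (if i.+1 == N then Z else 0)) *m u i.+1
  + (if (i.+1 < N)%N then Tt T i.+2 *m u i.+2 else 0) + adjmx (Tt T i.+1) *m u i.
Proof.
move=> u; have xE : x = mxcol (subcol x) by rewrite submxcolK.
rewrite {1}xE /Hmat mul_mxblock_mxrow mxcolK.
pose h1 (j : 'I_N) := if j == i :> nat then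
  (V i.+1 - (if i.+1 == N then Z else 0)) *m u j.+1 else 0.
pose h2 (j : 'I_N) := if j == i.+1 :> nat then Tt T i.+2 *m u j.+1 else 0.
pose h3 (j : 'I_N) := if i == j.+1 :> nat then adjmx (Tt T i.+1) *m u j.+1 else 0.
transitivity (\sum_j (h1 j + h2 j + h3 j)).
  apply: eq_bigr => j _. rewrite -[rowsub _ x]/(subcol x j) -(blocksE _ x 0) -/u /h1 /h2 /h3 -val_eqE eq_sym /=.
  case: eqP => [->|_].
    by rewrite !(ltn_eqF (ltnSn _)) !addr0.
  case: eqP => [->|_]; first by rewrite (ltn_eqF (leqnSn _)) add0r addr0.
  by case: eqP => _; rewrite ?mul0mx !add0r ?addr0.
rewrite !big_split /= (sum_ord_eq _ h1 (fun j => (V i.+1 - (if i.+1 == N then Z else 0)) *m u j.+1) i) //.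
rewrite (sum_ord_eq _ h2 (fun j => Tt T i.+2 *m u j.+1) i.+1) // ltn_ord.
congr (_ + _); rewrite /h3; case: i @h1 @h2 @h3 => -[|i] iN h1 h2 h3.
  by rewrite big1 /= ?oppr0 ?mulmx0.
rewrite (sum_ord_eq _ _ (fun j => adjmx (Tt T i.+2) *m u j.+1) i) //= ?(ltnW iN) //.
by move=> j; rewrite eqSS eq_sym.
Qed.

Definition first_block p (y : 'M[R[i]]_(L, p)) : 'M[R[i]]_(NL, p) :=
  @mxcol _ N (fun=> L) p (fun i => if i == 0 :> nat then y else 0).

Lemma three_term_Hmat p (x : 'M[R[i]]_(NL, p)) y :
  (H - z%:M) *m x = first_block p y -> three_term (blocks x y).
Proof.
move=> Hx n nN; have := congr1 (fun M => subcol M (Ordinal nN)) Hx.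
rewrite mulmxBl mul_scalar_mx /first_block mxcolK.
have -> : subcol (H *m x - z *: x) (Ordinal nN)
    = subcol (H *m x) (Ordinal nN) - z *: blocks x y n.+1.
  by rewrite -[n]/(val (Ordinal nN)) blocksE; apply/matrixP => k l; rewrite !mxE.
rewrite subcol_Hmat; case: n nN {Hx} => [|n] nN; move/eqP; rewrite subr_eq => /eqP h.
  apply/eqP; rewrite -(inj_eq (addrI y)) -h /= oppr0 mulmx0 addr0.
  by rewrite /Tt /= adjmx1 mul1mx addrC subrK.
by rewrite add0r in h; rewrite -h.
Qed.

(** A matrix killed by [H - z] solves the recursion with [u 0 = 0], so uniqueness applies to its
    blocks. *)
Lemma resolvent_unit : A N + Z *m C N \in unitmx -> H - z%:M \in unitmx.
Proof.
move=> hu; apply: unitmx_ker => X X0.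
have X0' : (H - z%:M) *m X = first_block _ 0.
  rewrite X0 /first_block; apply/esym/matrixP => k l; rewrite !mxE.
  by case: ifP; rewrite mxE.
have u0 := three_term_unique _ (three_term_Hmat _ _ _ X0') (oppr0 _) hu.
rewrite -[X](@submxcolK _ N (fun=> L)); apply/matrixP => k l; rewrite !mxE.
have /matrixP/(_ (tagnat.sig2 k) l) := u0 (tagnat.sig1 k).+1 (ltn_ord _).
by rewrite blocksE !mxE.
Qed.

(** The first block column of the resolvent solves the recursion with source 1, that is [u 0 = - 1],
    and its first block [u 1] is the Green block. *)
Lemma green_boundary : A N + Z *m C N \in unitmx ->
  (A N + Z *m C N) *m
    @submxblock _ N N (fun=> L) (fun=> L) (invmx (H - z%:M)) (Ordinal N_gt0) (Ordinal N_gt0)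
  = B N + Z *m D N.
Proof.
move=> hu; have rU := resolvent_unit hu.
set K := H - z%:M in rU *; set o := Ordinal N_gt0.
rewrite submxblockEh; set x := submxrow _ o.
have Kx : K *m x = first_block _ 1%:M.
  rewrite /x -submxrowM mulmxV // -[LHS](@submxcolK _ N (fun=> L)) /first_block.
  congr mxcol; apply: functional_extensionality_dep => i.
  rewrite -submxblockEh; apply/matrixP => k l; rewrite submxblock1.
  case: (eqVneq i o) => [->|io] /=; first by rewrite mxE -val_eqE.
  by have /negPf -> : i != 0 :> nat := io; rewrite mxE.
have := three_term_solution _ (three_term_Hmat _ _ _ Kx).
by rewrite -[1%N]/(val o).+1 blocksE /= mulmxN mulmx1 opprK.
Qed.

End Green.

(** * Cayley transform and Neumann series of the Green block *)

Lemma cayley_mobius {R : realType} {L : nat} (U X Y : 'M[R[i]]_L) :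
  unitary_mx U -> U - 1%:M \in unitmx ->
  (1%:M - adjmx U) *m (X + cayley_Z U *m Y)
    = (X + 'i *: Y) - adjmx U *m (X - 'i *: Y).
Proof.
move=> /eqP uU U1; rewrite mulmxDr mulmxA /cayley_Z -scalemxAr mulmxA.
have W1 : 1%:M - adjmx U = adjmx U *m (U - 1%:M) by rewrite mulmxBr uU mulmx1.
rewrite [in X in _ + X]W1 mulmxK // mulmxDr uU mulmx1 -scalemxAl mulmxBl mulmxBr mulmxDl !mul1mx.
by rewrite -scalemxAr; apply/matrixP => i j; rewrite !mxE; ring.
Qed.

Definition neumann {R : realType} {L : nat} (S W : 'M[R[i]]_L) : 'M[R[i]]_L :=
  invmx (1%:M - W *m S) *m W.

(** Rests on the splitting [b - W b' = (1 - W S) b + W (S b - b')], which separates the constant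
    [a^-1 b] from what carries a factor [W]. *)
Lemma neumann_mobius {R : realType} {L : nat} (a S b b' W G : 'M[R[i]]_L) :
  a \in unitmx -> 1%:M - W *m S \in unitmx ->
  (1%:M - W *m S) *m a *m G = b - W *m b' ->
  G = invmx a *m b + invmx a *m neumann S W *m (S *m b - b').
Proof.
move=> ua uS h; apply: (can_inj (mulKmx ua)).
rewrite mulmxDr !mulmxA mulmxV // !mul1mx; apply: (can_inj (mulKmx uS)).
rewrite [LHS]mulmxA h mulmxDr [_ *m (neumann _ _ *m _)]mulmxA mulKVmx //.
by rewrite mulmxBl mul1mx mulmxBr !mulmxA addrA subrK.
Qed.

Section GreenSeries.
Context {R : realType} {L : nat}.
Variables (T V : nat -> 'M[R[i]]_L) (N : nat).
Hypothesis N_gt0 : (0 < N)%N.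
Hypothesis T_unit : forall n, (2 <= n <= N)%N -> T n \in unitmx.
Hypothesis V_sa : forall n, (1 <= n <= N)%N -> adjmx (V n) = V n.
Variable z : R[i].
Hypothesis z_gt0 : 0 < complex.Im z.

Local Notation a := (Ablk T V z N + 'i *: Cblk T V z N).
Local Notation a' := (Ablk T V z N - 'i *: Cblk T V z N).
Local Notation b := (Bblk T V z N + 'i *: Dblk T V z N).
Local Notation b' := (Bblk T V z N - 'i *: Dblk T V z N).

Lemma Gfun_neumann (U : 'M[R[i]]_L) : unitary_mx U -> U - 1%:M \in unitmx ->
  Gfun N_gt0 T V z U = invmx a *m b
    + invmx a *m neumann (a' *m invmx a) (adjmx U) *m (a' *m invmx a *m b - b').
Proof.
move=> uU U1; have ua : a \in unitmx by apply: boundary_unit.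
have uW := unitary_adjmx _ uU.
have [s [s0 s1 contr]] := boundary_contraction _ _ _ N_gt0 T_unit V_sa _ z_gt0.
have uS := contraction_unit _ _ s0 s1 contr _ uW.
have W1 : 1%:M - adjmx U = adjmx U *m (U - 1%:M).
  by rewrite mulmxBr (eqP uU) mulmx1.
have hA : (1%:M - adjmx U) *m (Ablk T V z N + cayley_Z U *m Cblk T V z N)
    = (1%:M - adjmx U *m (a' *m invmx a)) *m a.
  by rewrite (cayley_mobius _ _ _ uU U1) mulmxBl mul1mx mulmxA mulmxKV.
have uW1 : 1%:M - adjmx U \in unitmx.
  by rewrite W1 unitmx_mul U1 andbT -unitmx_adj adjmxK; case/mulmx1_unit: (eqP uU).
(* The factorization does double duty: the product of [1 - U^*] with [A + Z C] is the invertible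
   [(1 - W S) a], so [A + Z C] is invertible and the Green block is a genuine resolvent block. *)
have uAZ : Ablk T V z N + cayley_Z U *m Cblk T V z N \in unitmx.
  have : (1%:M - adjmx U) *m (Ablk T V z N + cayley_Z U *m Cblk T V z N) \in unitmx.
    by rewrite hA unitmx_mul uS ua.
  by rewrite unitmx_mul => /andP[].
apply: neumann_mobius => //; rewrite -hA -mulmxA.
rewrite (green_boundary _ _ _ N_gt0 T_unit _ _ uAZ).
exact: cayley_mobius.
Qed.

End GreenSeries.

Section NeumannSeries.
Context {R : realType} {L : nat}.
Variables (S : 'M[R[i]]_L) (s : R).
Hypotheses (s0 : 0 <= s) (s1 : s < 1).
Hypothesis contrS : forall X, frob (S *m X) <= s * frob X.

(** Iterates the fixed-point equation [X = W + W S X] of the Neumann sum. *)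
Lemma neumann_expand W n : unitary_mx W ->
  neumann S W = \sum_(k < n) iter k (mulmx (W *m S)) W
    + iter n (mulmx (W *m S)) (neumann S W).
Proof.
move=> uW; have uS := contraction_unit _ _ s0 s1 contrS _ uW.
have fixN : neumann S W = W + W *m S *m neumann S W.
  by apply/eqP; rewrite -subr_eq -{1}[neumann S W]mul1mx -mulmxBl /neumann mulKVmx.
elim: n => [|n IH]; first by rewrite big_ord0 add0r.
have iterD k (X Y : 'M[R[i]]_L) : iter k (mulmx (W *m S)) (X + Y)
    = iter k (mulmx (W *m S)) X + iter k (mulmx (W *m S)) Y.
  by elim: k => //= k ->; rewrite mulmxDr.
by rewrite {1}IH {1}fixN iterD -iterSr big_ord_recr addrA.
Qed.

(** The case [n = 0] is used as well: it bounds the Neumann sum itself on all unitaries. *)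
Lemma frob_neumann_remainder : exists2 c, 0 < c & forall n W, unitary_mx W ->
  frob (iter n (mulmx (W *m S)) (neumann S W)) <= s ^+ n * c.
Proof.
have [c c0 hc] := contraction_bounded _ _ s0 s1 contrS.
(* [frob 1] is the value of [frob W] at every unitary [W]; the added 1 keeps the constant positive
   when [L = 0]. *)
exists (c * (frob (1%:M : 'M[R[i]]_L) + 1)) => [|n W uW].
  by rewrite mulr_gt0 // ltr_wpDl ?frob_ge0.
have uS := contraction_unit _ _ s0 s1 contrS _ uW.
apply: le_trans (frob_contraction_iter _ _ s0 contrS W _ n uW) _.
rewrite ler_wpM2l ?exprn_ge0 //; apply: le_trans (hc W _ uW) _.
rewrite /neumann mulKVmx // -[W in frob W]mulmx1 (frob_unitary _ _ uW).
by rewrite ler_wpM2l ?lerDl // ltW.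
Qed.

Lemma neumann_term_scale (t : R[i]) W k :
  iter k (mulmx ((t *: W) *m S)) (t *: W) = t ^+ k.+1 *: iter k (mulmx (W *m S)) W.
Proof.
elim: k => [|k IH] /=; first by rewrite expr1.
by rewrite IH -!scalemxAl -!scalemxAr scalerA -exprS.
Qed.

End NeumannSeries.

(** * Measurability and continuity of matrix-valued functions *)

Section Closure.
Context {R : realType} {X : Type}.
Variable Q : (X -> R[i]) -> Prop.
Hypothesis Qcst : forall c, Q (fun=> c).
Hypothesis QD : forall f g, Q f -> Q g -> Q (fun x => f x + g x).
Hypothesis QM : forall f g, Q f -> Q g -> Q (fun x => f x * g x).

(** [Q] is instantiated by right continuity at 0, by measurability, and by measurability with a
    bound on unitaries, so each matrix construction is treated once for all three. *)
Definition entrywise {m n} (F : X -> 'M[R[i]]_(m, n)) := forall i j, Q (fun x => F x i j).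

Lemma closed_sum (I : Type) (r : seq I) (P : pred I) (F : I -> X -> R[i]) :
  (forall i, Q (F i)) -> Q (fun x => \sum_(i <- r | P i) F i x).
Proof.
move=> QF; elim: r => [|i r IH].
  by under eq_fun do rewrite big_nil; apply: Qcst.
under eq_fun do rewrite big_cons; case: (P i) => //.
exact: QD.
Qed.

Lemma closed_prod (I : Type) (r : seq I) (P : pred I) (F : I -> X -> R[i]) :
  (forall i, Q (F i)) -> Q (fun x => \prod_(i <- r | P i) F i x).
Proof.
move=> QF; elim: r => [|i r IH].
  by under eq_fun do rewrite big_nil; apply: Qcst.
under eq_fun do rewrite big_cons; case: (P i) => //.
exact: QM.
Qed.

Lemma entrywise_cst m n (A : 'M[R[i]]_(m, n)) : entrywise (fun=> A).
Proof. by move=> i j; apply: Qcst. Qed.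

Lemma entrywiseD m n (F G : X -> 'M[R[i]]_(m, n)) :
  entrywise F -> entrywise G -> entrywise (fun x => F x + G x).
Proof. by move=> QF QG i j; under eq_fun do rewrite mxE; apply: QD. Qed.

Lemma entrywiseZ m n (f : X -> R[i]) (F : X -> 'M[R[i]]_(m, n)) :
  Q f -> entrywise F -> entrywise (fun x => f x *: F x).
Proof. by move=> Qf QF i j; under eq_fun do rewrite mxE; apply: QM. Qed.

Lemma entrywiseN m n (F : X -> 'M[R[i]]_(m, n)) :
  entrywise F -> entrywise (fun x => - F x).
Proof.
by move=> QF; under eq_fun do rewrite -scaleN1r; apply: entrywiseZ => //; apply: Qcst.
Qed.

Lemma entrywiseB m n (F G : X -> 'M[R[i]]_(m, n)) :
  entrywise F -> entrywise G -> entrywise (fun x => F x - G x).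
Proof. by move=> QF QG; apply: entrywiseD => //; apply: entrywiseN. Qed.

Lemma entrywiseM m n p (F : X -> 'M[R[i]]_(m, n)) (G : X -> 'M[R[i]]_(n, p)) :
  entrywise F -> entrywise G -> entrywise (fun x => F x *m G x).
Proof.
move=> QF QG i j; under eq_fun do rewrite mxE.
by apply: closed_sum => k; apply: QM.
Qed.

Lemma entrywise_scalar n (f : X -> R[i]) : Q f -> entrywise (fun x => (f x)%:M : 'M[R[i]]_n).
Proof.
move=> Qf; under eq_fun do rewrite -scalemx1.
by apply: entrywiseZ => //; apply: entrywise_cst.
Qed.

Lemma entrywise_block m1 m2 n1 n2 (F : X -> 'M[R[i]]_(m1, n1)) (G : X -> 'M[R[i]]_(m1, n2))
    (H : X -> 'M[R[i]]_(m2, n1)) (K : X -> 'M[R[i]]_(m2, n2)) :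
  entrywise F -> entrywise G -> entrywise H -> entrywise K ->
  entrywise (fun x => block_mx (F x) (G x) (H x) (K x)).
Proof.
move=> QF QG QH QK i j.
by case: (split_ordP i) => i' ->; case: (split_ordP j) => j' ->; under eq_fun do
  rewrite ?(block_mxEul, block_mxEur, block_mxEdl, block_mxEdr).
Qed.

Lemma closed_det n (F : X -> 'M[R[i]]_n) : entrywise F -> Q (fun x => \det (F x)).
Proof.
move=> QF; apply: closed_sum => s; apply: QM; first exact: Qcst.
by apply: closed_prod => i; apply: QF.
Qed.

Lemma entrywise_adj n (F : X -> 'M[R[i]]_n) : entrywise F -> entrywise (fun x => \adj (F x)).
Proof.
move=> QF i j; under eq_fun do rewrite mxE; apply: QM; first exact: Qcst.
by apply: closed_det => k l; under eq_fun do rewrite !mxE; apply: QF.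
Qed.

(* In a field [0^-1 = 0], so this expresses both branches of [invmx]. *)
Lemma invmxE n (A : 'M[R[i]]_n) :
  invmx A = (\det A)^-1 *: \adj A + (1 - \det A * (\det A)^-1) *: A.
Proof.
rewrite /invmx unitmxE unitfE; case: eqP => [->|/eqP dA] /=.
  by rewrite invr0 scale0r mul0r subr0 scale1r add0r.
by rewrite mulfV // subrr scale0r addr0.
Qed.

(** Only the reciprocal of this one determinant is assumed in [Q]: measurability always passes to
    reciprocals, right continuity only when the value at 0 is nonzero. *)
Lemma entrywise_inv n (F : X -> 'M[R[i]]_n) :
  Q (fun x => (\det (F x))^-1) -> entrywise F -> entrywise (fun x => invmx (F x)).
Proof.
move=> Qd QF; under eq_fun do rewrite invmxE.
apply: entrywiseD; apply: entrywiseZ => //; first exact: entrywise_adj.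
apply: QD; first exact: Qcst.
under eq_fun do rewrite -mulN1r; apply: QM; first exact: Qcst.
by apply: QM => //; apply: closed_det.
Qed.

Lemma entrywise_transfer {L : nat} (T V : nat -> 'M[R[i]]_L) (z : X -> R[i]) n :
  Q z -> entrywise (fun x => transfer T V (z x) n).
Proof.
move=> Qz; elim: n => [|n IH] /=; first exact: entrywise_cst.
apply: entrywiseM => //; apply: entrywise_block; try exact: entrywise_cst.
apply: entrywiseM; last exact: entrywise_cst.
by apply: entrywiseB; [apply: entrywise_scalar | apply: entrywise_cst].
Qed.

Section Adj.
Hypothesis QJ : forall f, Q f -> Q (fun x => (f x)^*%C).

Lemma entrywise_adjmx n (F : X -> 'M[R[i]]_n) : entrywise F -> entrywise (fun x => adjmx (F x)).
Proof. by move=> QF i j; under eq_fun do rewrite !mxE; apply: QJ. Qed.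

End Adj.

Lemma entrywise_Gfun {L : nat} (N : nat) (hN : (0 < N)%N) (T V : nat -> 'M[R[i]]_L) z
    (U : X -> 'M[R[i]]_L) :
  (forall f, Q f -> Q (fun x => (f x)^-1)) ->
  entrywise U -> entrywise (fun x => Gfun hN T V z (U x)).
Proof.
move=> QV QU i j; under eq_fun do rewrite mxE.
have Qinv n (F : X -> 'M[R[i]]_n) : entrywise F -> entrywise (fun x => invmx (F x)).
  by move=> QF; apply: entrywise_inv => //; apply: QV; apply: closed_det.
have QZ : entrywise (fun x => cayley_Z (U x)).
  apply: entrywiseZ; first exact: Qcst; apply: entrywiseM.
    by apply: Qinv; apply: entrywiseB => //; apply: entrywise_cst.
  by apply: entrywiseD => //; apply: entrywise_cst.
apply: Qinv; apply: entrywiseB; last exact: entrywise_cst.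
move=> k l; rewrite /Hmat /mxblock; under eq_fun do rewrite mxE.
case: (tagnat.sig1 k == _); last exact: Qcst.
apply: entrywiseB => [|p q]; first exact: entrywise_cst.
by case: (_ == N); [apply: QZ | apply: Qcst].
Qed.

End Closure.

Section RightContinuity.
Context {R : realType}.

Definition right_continuous0 (f : R -> R[i]) :=
  (complex.Re (f x) @[x --> 0^'+] --> complex.Re (f 0)) /\
  (complex.Im (f x) @[x --> 0^'+] --> complex.Im (f 0)).

Local Notation Q := right_continuous0.

Lemma right_continuous0_cst c : Q (fun=> c).
Proof. by split; apply: cvg_cst. Qed.

Lemma RecD (x y : R[i]) : complex.Re (x + y) = complex.Re x + complex.Re y.
Proof. by case: x y => ? ? []. Qed.

Lemma ImcD (x y : R[i]) : complex.Im (x + y) = complex.Im x + complex.Im y.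
Proof. by case: x y => ? ? []. Qed.

Lemma RecM (x y : R[i]) : complex.Re (x * y)
  = complex.Re x * complex.Re y - complex.Im x * complex.Im y.
Proof. by case: x y => ? ? []. Qed.

Lemma ImcM (x y : R[i]) : complex.Im (x * y)
  = complex.Re x * complex.Im y + complex.Im x * complex.Re y.
Proof. by case: x y => ? ? []. Qed.

Lemma RecJ (x : R[i]) : complex.Re x^*%C = complex.Re x.
Proof. by case: x. Qed.

Lemma ImcJ (x : R[i]) : complex.Im x^*%C = - complex.Im x.
Proof. by case: x. Qed.

Lemma RecV (x : R[i]) : complex.Re x^-1 = complex.Re x * (sqnorm x)^-1.
Proof. by case: x. Qed.

Lemma ImcV (x : R[i]) : complex.Im x^-1 = - (complex.Im x * (sqnorm x)^-1).
Proof. by case: x. Qed.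

Lemma right_continuous0D f g : Q f -> Q g -> Q (fun x => f x + g x).
Proof.
move=> [f1 f2] [g1 g2]; split.
  by under eq_fun do rewrite RecD; rewrite RecD; apply: cvgD.
by under eq_fun do rewrite ImcD; rewrite ImcD; apply: cvgD.
Qed.

Lemma right_continuous0M f g : Q f -> Q g -> Q (fun x => f x * g x).
Proof.
move=> [f1 f2] [g1 g2]; split.
  by under eq_fun do rewrite RecM; rewrite RecM; apply: cvgB; apply: cvgM.
by under eq_fun do rewrite ImcM; rewrite ImcM; apply: cvgD; apply: cvgM.
Qed.

Lemma right_continuous0J f : Q f -> Q (fun x => (f x)^*%C).
Proof.
move=> [f1 f2]; split; first by under eq_fun do rewrite RecJ; rewrite RecJ.
by under eq_fun do rewrite ImcJ; rewrite ImcJ; apply: cvgN.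
Qed.

Lemma right_continuous0V f : f 0 != 0 -> Q f -> Q (fun x => (f x)^-1).
Proof.
move=> f0 [f1 f2]; have cn : (sqnorm (f x))^-1 @[x --> 0^'+] --> (sqnorm (f 0))^-1.
  apply: cvgV; first by rewrite sqnorm_eq0.
  by rewrite /sqnorm; apply: cvgD; rewrite !expr2; under eq_fun do rewrite expr2; apply: cvgM.
split; first by under eq_fun do rewrite RecV; rewrite RecV; apply: cvgM.
by under eq_fun do rewrite ImcV; rewrite ImcV; apply: cvgN; apply: cvgM.
Qed.

End RightContinuity.

Section MeasurableComplex.
Context {d : measure_display} {X : measurableType d} {R : realType}.

Definition cmeasurable (f : X -> R[i]) :=
  measurable_fun setT (fun x => complex.Re (f x)) /\
  measurable_fun setT (fun x => complex.Im (f x)).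

Local Notation Q := cmeasurable.

Lemma cmeasurable_cst c : Q (fun=> c).
Proof. by split; apply: measurable_cst. Qed.

Lemma cmeasurableD f g : Q f -> Q g -> Q (fun x => f x + g x).
Proof.
move=> [f1 f2] [g1 g2]; split.
  by under eq_fun do rewrite RecD; apply: measurable_funD.
by under eq_fun do rewrite ImcD; apply: measurable_funD.
Qed.

Lemma cmeasurableM f g : Q f -> Q g -> Q (fun x => f x * g x).
Proof.
move=> [f1 f2] [g1 g2]; split.
  by under eq_fun do rewrite RecM; apply: measurable_funB; apply: measurable_funM.
by under eq_fun do rewrite ImcM; apply: measurable_funD; apply: measurable_funM.
Qed.

Lemma cmeasurableJ f : Q f -> Q (fun x => (f x)^*%C).
Proof.
move=> [f1 f2]; split; first by under eq_fun do rewrite RecJ.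
by under eq_fun do rewrite ImcJ; apply: measurableT_comp.
Qed.

Lemma measurable_sqnorm f : Q f -> measurable_fun setT (fun x => sqnorm (f x)).
Proof.
by move=> [f1 f2]; apply: measurable_funD; under eq_fun do rewrite expr2; apply: measurable_funM.
Qed.

Lemma cmeasurableV f : Q f -> Q (fun x => (f x)^-1).
Proof.
move=> Qf; have mn : measurable_fun setT (fun x => (sqnorm (f x))^-1).
  (* The power function with exponent -1 is measurable on the whole line and agrees with the
     reciprocal on nonnegative reals, including the default value at 0. *)
  under eq_fun do rewrite -powR_inv1 ?sqnorm_ge0 //.
  by apply: (measurableT_comp (measurable_powR (-1))); apply: measurable_sqnorm.
case: Qf => f1 f2; split.
  by under eq_fun do rewrite RecV; apply: measurable_funM.
under eq_fun do rewrite ImcV; apply: measurableT_comp => //.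
exact: measurable_funM.
Qed.

End MeasurableComplex.

(** * Integration against Haar measure *)

Section HaarIntegral.
Context {R : realType} {L : nat}.
Variable P : probability (MxSpace R L) R.
Hypothesis haarP : is_haar P.

Local Notation MX := (MxSpace R L).
Local Notation M := 'M[R[i]]_L.
Local Notation Q := (@cmeasurable _ MX R).

Lemma measurable_coord : entrywise Q (fun U : MX => (U : M)).
Proof.
move=> i j; split=> _ A mA; rewrite setTI; apply: sub_sigma_algebra.
  by exists i, j, A; split=> //; left.
by exists i, j, A; split=> //; right.
Qed.

Lemma measurable_lmul (W : M) : measurable_fun setT (fun U : MX => (W *m U : MX)).
Proof.
have mW : entrywise Q (fun U : MX => W *m U).
  apply: (entrywiseM _ cmeasurable_cst cmeasurableD cmeasurableM _ _ _ _ _ _ measurable_coord).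
  exact: (entrywise_cst _ cmeasurable_cst).
apply: (@measurability _ _ MX MX setT (fun U => W *m U : MX) (@mx_gen R L) erefl) => _ [B [i [j [A [mA BA]]]] <-].
have [mRe mIm] := mW i j; case: BA => ->.
  exact: mRe.
exact: mIm.
Qed.

Definition unitary_set : set MX := [set U | unitary_mx (U : M)].

Lemma measurable_unitary : measurable unitary_set.
Proof.
have mF : entrywise Q (fun U : MX => adjmx (U : M) *m (U : M) - 1%:M).
  apply: (entrywiseB _ cmeasurable_cst cmeasurableD cmeasurableM);
    last exact: (entrywise_cst _ cmeasurable_cst).
  apply: (entrywiseM _ cmeasurable_cst cmeasurableD cmeasurableM);
    last exact: measurable_coord.
  exact: (entrywise_adjmx _ cmeasurableJ _ _ measurable_coord).
have -> : unitary_set = (fun U : MX => frob (adjmx (U : M) *m (U : M) - 1%:M)) @^-1` [set 0].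
  apply/seteqP; split=> U /=; rewrite /unitary_set /unitary_mx /=.
    by move=> /eqP ->; rewrite subrr frob0.
  by move=> /frob_eq0/eqP; rewrite subr_eq0.
rewrite -[X in measurable X]setTI; suff : measurable_fun setT
    (fun U : MX => frob (adjmx (U : M) *m (U : M) - 1%:M)) by apply.
by apply: measurable_sum => i; apply: measurable_sum => j; apply: measurable_sqnorm.
Qed.

Lemma unitary_setC_null : P (~` unitary_set) = 0%E.
Proof.
by rewrite probability_setC ?haarP.1 ?subee //; apply: measurable_unitary.
Qed.

Definition ubounded (f : MX -> R) := measurable_fun setT f /\
  exists c, forall U, unitary_set U -> `|f U| <= c.

Lemma ubounded_integrable f : ubounded f -> P.-integrable setT (EFin \o f).
Proof.
move=> [mf [c bf]]; have mE : measurable_fun setT (EFin \o f) by exact/measurable_EFinP.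
apply/(negligible_integrable (measurableC measurable_unitary) measurableT mE unitary_setC_null).
rewrite setTD setCK; apply: measurable_bounded_integrable.
- exact: measurable_unitary.
- by rewrite -ge0_fin_numE // fin_num_measure //; exact: measurable_unitary.
- exact: measurable_funTS.
- exists c; split; first exact: num_real.
  by move=> x cx U uU /=; apply: le_trans (bf U uU) (ltW cx).
Qed.

Lemma Rintegral_ae (f g : MX -> R) (D : set MX) :
  measurable D -> P (~` D) = 0%E -> measurable_fun setT f -> measurable_fun setT g ->
  (forall U, D U -> f U = g U) -> Rintegral P setT f = Rintegral P setT g.
Proof.
move=> mD D0 mf mg fg; rewrite /Rintegral; congr fine; apply: ae_eq_integral => //.
- exact/measurable_EFinP.
- exact/measurable_EFinP.
- exists (~` D); split=> //; first exact: measurableC.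
  by move=> U /= h DU; apply: h => _; rewrite fg.
Qed.

Lemma Rintegral_lmul f W : unitary_mx W -> ubounded f ->
  Rintegral P setT (fun U : MX => f (W *m U)) = Rintegral P setT f.
Proof.
move=> uW bf; rewrite /Rintegral; congr fine.
have mW := measurable_lmul W.
have bfW : ubounded (fun U : MX => f (W *m U)).
  case: bf => mf [c cf]; split; first exact: (measurableT_comp mf mW).
  exists c => U uU; apply: cf; rewrite /unitary_set /unitary_mx /= adjmxM.
  by rewrite mulmxA -(mulmxA _ _ W) (eqP uW) mulmx1.
have /= <- := @integral_pushforward _ _ MX MX R _ mW P setT (EFin \o f) _ _ measurableT.
- by apply: eq_measure_integral => A mA _; apply: haarP.2.
- by apply/measurable_EFinP; exact: bf.1.
- exact: ubounded_integrable.
Qed.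

Lemma Rintegral_le f c : ubounded f -> (forall U, unitary_set U -> `|f U| <= c) ->
  `|Rintegral P setT f| <= c.
Proof.
move=> bf fc; have mU := measurable_unitary.
(* The identity is unitary, so the bound forces [0 <= c]; this is needed where the cut-off below is
   zero. *)
have uc0 : exists U, unitary_set U by exists (1%:M : M); rewrite /unitary_set /= /unitary_mx adjmx1 mulmx1.
have c0 : 0 <= c by have [U /fc] := uc0; apply: le_trans.
(* Cutting [f] off outside the unitaries leaves the integral unchanged and makes the bound hold
   everywhere, as monotonicity of the integral requires. *)
pose g U := f U * \1_unitary_set U.
have mi : measurable_fun setT (\1_unitary_set : MX -> R) by exact: measurable_indic.
have bg U : `|g U| <= c.
  rewrite /g indicE; case: (boolP (U \in unitary_set)) => [|_]; last by rewrite mulr0 normr0.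
  by rewrite inE mulr1; apply: fc.
have mg : measurable_fun setT g by apply: measurable_funM => //; exact: bf.1.
have Bg : ubounded g by split=> //; exists c.
have bc : ubounded (fun=> c) by split; [exact: measurable_cst | exists `|c|].
rewrite (Rintegral_ae _ g _ mU unitary_setC_null bf.1 mg) => [|U uU]; last first.
  by rewrite /g indicE mem_set ?mulr1.
have ng : ubounded (fun U => `|g U|).
  by split; [exact: measurableT_comp | exists c => U _; rewrite normr_id].
apply: le_trans (le_normr_Rintegral measurableT (ubounded_integrable _ Bg)) _.
apply: le_trans (le_Rintegral measurableT (ubounded_integrable _ ng)
  (ubounded_integrable _ bc) (fun U _ => bg U)) _.
rewrite Rintegral_cst //.
have : c * fine (P setT) <= c by rewrite probability_setT mulr1.
exact.
Qed.

End HaarIntegral.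

(** * Unitaries with eigenvalue 1 form a null set *)

Lemma unitary_scalar {R : realType} {L : nat} (t : R[i]) :
  t^*%C * t = 1 -> unitary_mx (t%:M : 'M[R[i]]_L).
Proof. by move=> tt; rewrite /unitary_mx adjmx_scalar -scalar_mxM tt. Qed.

(** Cayley images of the natural numbers: infinitely many points of the unit circle whose
    distinctness is elementary algebra, without roots of unity or exponentials. *)
Definition phase {R : realType} (k : nat) : R[i] :=
  Complex 1 (- k%:R) / Complex 1 k%:R.

Lemma complex_1_neq0 {R : realType} (e : R) : Complex 1 e != 0 :> R[i].
Proof. by rewrite eq_complex /= oner_eq0. Qed.

Lemma phase_unimodular {R : realType} k : (@phase R k)^*%C * phase k = 1.
Proof.
have kJ : (Complex 1 k%:R : R[i])^*%C = Complex 1 (- k%:R) by [].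
have kJ' : (Complex 1 (- k%:R) : R[i])^*%C = Complex 1 k%:R by simpc.
have divJ (x y : R[i]) : (x / y)^*%C = x^*%C / y^*%C by rewrite rmorphM fmorphV.
rewrite /phase divJ kJ kJ' mulrACA -invfM.
by rewrite [X in _ / X]mulrC mulfV ?mulf_neq0 ?complex_1_neq0.
Qed.
Lemma phase_inj {R : realType} : injective (@phase R).
Proof.
move=> j k /eqP; rewrite /phase eqr_div ?complex_1_neq0 // => /eqP[_ h].
by apply/eqP; rewrite -(eqr_nat R); apply/eqP; lra.
Qed.

(** A vanishing determinant makes [(phase k)^-1] an eigenvalue of [U]; these are distinct for
    distinct [k], and the characteristic polynomial has degree [L]. *)
Lemma det_phase_count {R : realType} {L : nat} (U : 'M[R[i]]_L) K :
  (\sum_(k < K) (\det ((phase k)%:M *m U - 1%:M) == 0)%R <= L)%N.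
Proof.
pose D := [pred k : 'I_K | \det ((phase k)%:M *m U - 1%:M) == 0].
have -> : (\sum_(k < K) (\det ((phase k)%:M *m U - 1%:M) == 0)%R = #|D|)%N.
  by rewrite -sum1_card [RHS]big_mkcond; apply: eq_bigr => k _; rewrite inE; case: (_ == _).
pose r := [seq (phase k : R[i])^-1 | k : 'I_K <- enum D].
have <- : size r = #|D| by rewrite size_map -cardE.
rewrite -ltnS -(size_char_poly U) max_poly_roots ?monic_neq0 ?char_poly_monic //.
  apply/allP => _ /mapP[k + ->]; rewrite mem_enum inE => /det0P[v v0 hv].
  rewrite -eigenvalue_root_char; apply/eigenvalueP; exists v => //.
  have p0 : phase k != 0 :> R[i] by rewrite mulf_neq0 ?invr_eq0 ?complex_1_neq0.
  apply: (scalerI p0); rewrite scalerA mulfV // scale1r.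
  by move/eqP: hv; rewrite mulmxBr mulmx1 subr_eq0 mul_scalar_mx -scalemxAr => /eqP.
by rewrite map_inj_uniq ?enum_uniq // => i j /invr_inj/phase_inj/val_inj.
Qed.

Section HaarNull.
Context {R : realType} {L : nat}.
Variable P : probability (MxSpace R L) R.
Hypothesis haarP : is_haar P.

Local Notation MX := (MxSpace R L).
Local Notation M := 'M[R[i]]_L.
Local Notation Q := (@cmeasurable _ MX R).

(** For [U = (-Z - i)(-Z + i)^-1] the value omitted by the Cayley transform is 1, so this is where
    [cayley_Z] inverts a singular matrix. *)
Definition cayley_singular : set MX := [set U | \det ((U : M) - 1%:M) == 0].

Lemma measurable_cayley_singular : measurable cayley_singular.
Proof.
have md : Q (fun U : MX => \det ((U : M) - 1%:M)).
  apply: (closed_det _ cmeasurable_cst cmeasurableD cmeasurableM).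
  apply: (entrywiseB _ cmeasurable_cst cmeasurableD cmeasurableM).
    exact: measurable_coord.
  exact: (entrywise_cst _ cmeasurable_cst).
have -> : cayley_singular = (fun U : MX => sqnorm (\det ((U : M) - 1%:M))) @^-1` [set 0].
  apply/seteqP; split=> U; rewrite /cayley_singular /= -sqnorm_eq0; first by move/eqP.
  by move=> ->.
rewrite -[X in measurable X]setTI; suff : measurable_fun setT
    (fun U : MX => sqnorm (\det ((U : M) - 1%:M))) by apply.
exact: measurable_sqnorm.
Qed.

(* At most [L] of the sets [t_k^-1 A] contain a given unitary, and they all have the measure of
   the set [A] of unitaries with eigenvalue 1. *)
Lemma cayley_singular_null : P cayley_singular = 0%E.
Proof.
have mA := measurable_cayley_singular.
pose A k := (fun U : MX => ((phase k)%:M *m U : MX)) @^-1` cayley_singular.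
have mAk k : measurable (A k).
  by rewrite -[A k]setTI; apply: measurable_lmul.
have PA k : P (A k) = P cayley_singular.
  by apply: haarP.2 => //; apply: unitary_scalar; apply: phase_unimodular.
have PAfin : P cayley_singular \is a fin_num by rewrite fin_num_measure.
rewrite -(fineK PAfin); congr EFin; set p := fine _.
have p0 : 0 <= p by rewrite fine_ge0.
have Kp K : K%:R * p <= L%:R.
  have : (\int[P]_(U in setT) (\sum_(k < K) (\1_(A k) U)%:E) <= \int[P]_(U in setT) (L%:R)%:E)%E.
    apply: ge0_le_integral => //.
    - by move=> U _; apply: sume_ge0 => k _; rewrite lee_fin.
    - apply: emeasurable_sum => k; apply/measurable_EFinP; exact: measurable_indic.
    - move=> U _; rewrite sumEFin lee_fin.
      have := det_phase_count (U : M) K; rewrite -(ler_nat R); apply: le_trans.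
      rewrite natr_sum; apply: ler_sum => k _; rewrite indicE.
      case: (boolP (U \in A k)) => //; rewrite inE /A /cayley_singular /= => -> //.
  have -> : (\int[P]_(U in setT) (L%:R : R)%:E = (L%:R)%:E)%E.
    rewrite integral_cst // -[RHS]mule1; congr (_ * _)%E; exact: probability_setT.
  rewrite ge0_integral_sum //.
  - rewrite (eq_bigr (fun=> p%:E)) => [|k _]; last first.
      by rewrite integral_indic // setIT; apply: etrans (PA k) _; rewrite fineK.
    by rewrite sumEFin lee_fin sumr_const card_ord mulr_natl.
  - by move=> k; apply/measurable_EFinP; exact: measurable_indic.
apply/eqP; rewrite eq_le p0 andbT leNgt; apply/negP => pgt.
have := Kp (Num.bound (L%:R / p)); rewrite leNgt -ltr_pdivrMr //.
by rewrite archi_boundP // divr_ge0.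
Qed.

End HaarNull.

(** * Complex and matrix expectations, and the vanishing of the Neumann sum *)

Section HaarExpectation.
Context {R : realType} {L : nat}.
Variable P : probability (MxSpace R L) R.
Hypothesis haarP : is_haar P.

Local Notation MX := (MxSpace R L).
Local Notation M := 'M[R[i]]_L.

(** Stable under sums, products and conjugation but not under reciprocals, so the Neumann sum enters
    this class through its norm estimate. *)
Definition cbounded (f : MX -> R[i]) := cmeasurable f /\
  exists c, forall U : MX, unitary_mx (U : M) -> sqnorm (f U) <= c.

Local Notation Q := cbounded.

Lemma cbounded_cst c : Q (fun=> c).
Proof. by split; [apply: cmeasurable_cst | exists (sqnorm c)]. Qed.

Lemma cboundedD f g : Q f -> Q g -> Q (fun U => f U + g U).
Proof.
move=> [mf [c hf]] [mg [d hg]]; split; first exact: cmeasurableD.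
exists (2 * c + 2 * d) => U uU; have := hf U uU; have := hg U uU.
case: (f U) (g U) => x y [x' y']; rewrite /sqnorm /= => h1 h2.
have := sqr_ge0 (x - x'); have := sqr_ge0 (y - y'); nra.
Qed.

Lemma cboundedM f g : Q f -> Q g -> Q (fun U => f U * g U).
Proof.
move=> [mf [c hf]] [mg [d hg]]; split; first exact: cmeasurableM.
exists (c * d) => U uU; rewrite sqnormM.
by apply: ler_pM; rewrite ?sqnorm_ge0 ?hf ?hg.
Qed.

Lemma cboundedJ f : Q f -> Q (fun U => (f U)^*%C).
Proof.
move=> [mf [c hf]]; split; first exact: cmeasurableJ.
by exists c => U uU; rewrite /sqnorm RecJ ImcJ sqrrN; apply: hf.
Qed.

Lemma sqnorm_le_norm (x : R[i]) e : 0 <= e -> sqnorm x <= e ^+ 2 ->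
  `|complex.Re x| <= e /\ `|complex.Im x| <= e.
Proof.
case: x => x y e0; rewrite /sqnorm /= => h.
have := sqr_ge0 x; have := sqr_ge0 y => hy hx; rewrite !real_ler_norml ?num_real //.
by split; rewrite -ler_norml -(ler_pXn2r (n := 2)) ?nnegrE // real_normK ?num_real //; lra.
Qed.

Lemma cbounded_ubounded f : Q f ->
  ubounded (fun U => complex.Re (f U)) /\ ubounded (fun U => complex.Im (f U)).
Proof.
move=> [[m1 m2] [c hf]].
(* This bound avoids a square root: [c] is at most the square of one plus its absolute value. *)
have h U : unitary_set U -> `|complex.Re (f U)| <= 1 + `|c| /\ `|complex.Im (f U)| <= 1 + `|c|.
  move=> uU; apply: sqnorm_le_norm; first by rewrite addr_ge0.
  apply: le_trans (hf U uU) _; apply: le_trans (ler_norm c) _.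
  have := normr_ge0 c; nra.
by split; split=> //; exists (1 + `|c|) => U /h[].
Qed.

Definition cexp (f : MX -> R[i]) : R[i] :=
  Complex (Rintegral P setT (fun U => complex.Re (f U)))
          (Rintegral P setT (fun U => complex.Im (f U))).

(** Measurability is all that is asked, so that one side may be [Gfun], for which no bound is
    established. *)
Lemma cexp_ae f g : cmeasurable f -> cmeasurable g ->
  (forall U : MX, unitary_mx (U : M) -> (U : M) - 1%:M \in unitmx -> f U = g U) ->
  cexp f = cexp g.
Proof.
move=> [f1 f2] [g1 g2] fg.
pose D : set MX := unitary_set `&` ~` cayley_singular.
have mU := @measurable_unitary R L; have mS := @measurable_cayley_singular R L.
have mD : measurable D by apply: measurableI => //; apply: measurableC.
have PD : P (~` D) = 0%E.
  apply/eqP; rewrite eq_le measure_ge0 andbT setCI setCK.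
  have h : (P (~` unitary_set) + P cayley_singular <= 0)%E.
    by rewrite unitary_setC_null // cayley_singular_null // adde0.
  by apply: le_trans (measureU2 _ _ _) h => //; apply: measurableC.
have fgD U : D U -> f U = g U.
  move=> [uU /negP nS]; apply: fg => //; rewrite unitmxE unitfE; exact: nS.
congr Complex; apply: (Rintegral_ae P _ _ D) => // U /fgD -> //.
Qed.

Lemma cexp_cst c : cexp (fun=> c) = c.
Proof.
have P1 : fine (P setT) = 1 by rewrite probability_setT.
by case: c => x y; rewrite /cexp !Rintegral_cst //=; congr Complex;
  rewrite -[RHS]mulr1; congr (_ * _).
Qed.

Lemma cexpD f g : Q f -> Q g -> cexp (fun U => f U + g U) = cexp f + cexp g.
Proof.
move=> /cbounded_ubounded[f1 f2] /cbounded_ubounded[g1 g2]; rewrite /cexp; simpc.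
under eq_Rintegral do rewrite RecD.
under [X in Complex _ X]eq_Rintegral do rewrite ImcD.
by congr Complex; rewrite RintegralD //; apply: ubounded_integrable.
Qed.

Lemma cexpZ c f : Q f -> cexp (fun U => c * f U) = c * cexp f.
Proof.
move=> /cbounded_ubounded[f1 f2]; case: c => x y; rewrite /cexp; simpc.
under eq_Rintegral do rewrite RecM /=.
under [X in Complex _ X]eq_Rintegral do rewrite ImcM /=.
have Z r g : ubounded g -> ubounded (fun U : MX => r * g U).
  move=> [mg [d hg]]; split; first exact: measurable_funM.
  by exists (`|r| * d) => U uU; rewrite normrM ler_wpM2l ?hg.
have i1 := ubounded_integrable _ haarP _ f1; have i2 := ubounded_integrable _ haarP _ f2.
congr Complex.
  rewrite RintegralB ?RintegralZl //; apply: ubounded_integrable => //; exact: Z.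
by rewrite RintegralD ?RintegralZl //; apply: ubounded_integrable => //; exact: Z.
Qed.

Lemma cexpJ f : Q f -> cexp (fun U => (f U)^*%C) = (cexp f)^*%C.
Proof.
move=> /cbounded_ubounded[f1 f2]; rewrite /cexp; simpc.
under eq_Rintegral do rewrite RecJ.
under [X in Complex _ X]eq_Rintegral do rewrite ImcJ -mulN1r.
by rewrite RintegralZl ?mulN1r //; apply: ubounded_integrable.
Qed.

Lemma cexp_lmul f W : unitary_mx W -> Q f -> cexp (fun U : MX => f (W *m U)) = cexp f.
Proof.
move=> uW /cbounded_ubounded[f1 f2]; congr Complex.
  exact: (Rintegral_lmul P haarP _ W uW f1).
exact: (Rintegral_lmul P haarP _ W uW f2).
Qed.

Lemma cexp_le f e : 0 <= e -> Q f ->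
  (forall U : MX, unitary_mx (U : M) -> sqnorm (f U) <= e ^+ 2) ->
  `|complex.Re (cexp f)| <= e /\ `|complex.Im (cexp f)| <= e.
Proof.
move=> e0 /cbounded_ubounded[f1 f2] fe.
by split; apply: Rintegral_le => // U /fe/(sqnorm_le_norm _ _ e0)[].
Qed.

Lemma cexp_sum (I : Type) (r : seq I) (F : I -> MX -> R[i]) :
  (forall i, Q (F i)) -> cexp (fun U => \sum_(i <- r) F i U) = \sum_(i <- r) cexp (F i).
Proof.
move=> QF; elim: r => [|i r IH].
  by under eq_fun do rewrite big_nil; rewrite big_nil; apply: cexp_cst.
under eq_fun do rewrite big_cons; rewrite big_cons cexpD ?IH //.
exact: (closed_sum _ cbounded_cst cboundedD).
Qed.

Lemma mx_integralE (F : MX -> M) i j : mx_integral P F i j = cexp (fun U => F U i j).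
Proof. by rewrite mxE. Qed.

Lemma mx_integral_ae (F G : MX -> M) :
  entrywise cmeasurable F -> entrywise cmeasurable G ->
  (forall U : MX, unitary_mx (U : M) -> (U : M) - 1%:M \in unitmx -> F U = G U) ->
  mx_integral P F = mx_integral P G.
Proof.
move=> mF mG FG; apply/matrixP => i j; rewrite !mx_integralE; apply: cexp_ae => //.
by move=> U uU U1; rewrite FG.
Qed.

Lemma mx_integral_affine (K A B : M) (F : MX -> M) : entrywise Q F ->
  mx_integral P (fun U => K + A *m F U *m B) = K + A *m mx_integral P F *m B.
Proof.
move=> QF; apply/matrixP => i j; rewrite mx_integralE.
have QA k l : Q (fun U => A i l * F U l k * B k j).
  apply: cboundedM (cbounded_cst _); exact: cboundedM (cbounded_cst _) (QF l k).
have E : (fun U => (K + A *m F U *m B) i j)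
    = (fun U => K i j + \sum_k \sum_l A i l * F U l k * B k j).
  apply/funext => U; rewrite !mxE; congr (_ + _); apply: eq_bigr => k _.
  by rewrite mxE mulr_suml.
rewrite E cexpD; first last.
- by do 2![apply: (closed_sum _ cbounded_cst cboundedD) => ?].
- exact: cbounded_cst.
rewrite cexp_cst cexp_sum => [|k]; last exact: (closed_sum _ cbounded_cst cboundedD).
rewrite !mxE; congr (_ + _); apply: eq_bigr => k _; rewrite cexp_sum // mxE mulr_suml.
apply: eq_bigr => l _; rewrite mx_integralE.
have -> : (fun U => A i l * F U l k * B k j) = (fun U => (A i l * B k j) * F U l k).
  by apply/funext => U; rewrite mulrAC.
by rewrite cexpZ // mulrAC.
Qed.

Lemma mx_integral_ImMx (F : MX -> M) : entrywise Q F ->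
  mx_integral P (fun U => ImMx (F U)) = ImMx (mx_integral P F).
Proof.
move=> QF; apply/matrixP => i j; rewrite mx_integralE.
set c := (2%:R * 'i : R[i])^-1.
have -> : (fun U => ImMx (F U) i j) = (fun U => c * (F U i j + (-1) * (F U j i)^*%C)).
  by apply/funext => U; rewrite !mxE mulN1r.
have QJ := cboundedJ _ (QF j i); have Q1 := cboundedM _ _ (cbounded_cst (-1)) QJ.
rewrite cexpZ; last exact: cboundedD.
by rewrite cexpD // cexpZ // cexpJ // !mxE mulN1r.
Qed.

Section Neumann.
Variables (S : M) (s : R).
Hypotheses (s0 : 0 <= s) (s1 : s < 1).
Hypothesis contrS : forall X, frob (S *m X) <= s * frob X.

Local Notation W := (fun U : MX => adjmx (U : M)).

Lemma cbounded_frob (F : MX -> M) c : entrywise cmeasurable F ->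
  (forall U : MX, unitary_mx (U : M) -> frob (F U) <= c) -> entrywise Q F.
Proof.
move=> mF hF i j; split; first exact: mF.
by exists c => U uU; apply: le_trans (sqnorm_le_frob _ i j) (hF U uU).
Qed.

Lemma measurable_adjmx : entrywise cmeasurable W.
Proof. exact: (entrywise_adjmx _ cmeasurableJ _ _ measurable_coord). Qed.

Lemma measurable_neumann : entrywise cmeasurable (fun U : MX => neumann S (adjmx (U : M))).
Proof.
apply: (entrywiseM _ cmeasurable_cst cmeasurableD cmeasurableM); last exact: measurable_adjmx.
have m1 : entrywise cmeasurable (fun U : MX => 1%:M - adjmx (U : M) *m S).
  apply: (entrywiseB _ cmeasurable_cst cmeasurableD cmeasurableM).
    exact: (entrywise_cst _ cmeasurable_cst).
  apply: (entrywiseM _ cmeasurable_cst cmeasurableD cmeasurableM); first exact: measurable_adjmx.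
  exact: (entrywise_cst _ cmeasurable_cst).
apply: (entrywise_inv _ cmeasurable_cst cmeasurableD cmeasurableM) => //.
by apply: cmeasurableV; apply: (closed_det _ cmeasurable_cst cmeasurableD cmeasurableM).
Qed.

Lemma cbounded_adjmx : entrywise Q W.
Proof.
apply: (cbounded_frob _ (frob (1%:M : M)) measurable_adjmx) => U uU.
by rewrite -[adjmx _]mulmx1 frob_unitary //; apply: unitary_adjmx.
Qed.

Lemma cbounded_iter k (F : MX -> M) : entrywise Q F ->
  entrywise Q (fun U : MX => iter k (mulmx (adjmx (U : M) *m S)) (F U)).
Proof.
move=> QF; elim: k => //= k IH.
apply: (entrywiseM _ cbounded_cst cboundedD cboundedM) => //.
apply: (entrywiseM _ cbounded_cst cboundedD cboundedM); first exact: cbounded_adjmx.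
exact: (entrywise_cst _ cbounded_cst).
Qed.

Lemma cbounded_neumann : entrywise Q (fun U : MX => neumann S (adjmx (U : M))).
Proof.
have [c c0 hc] := frob_neumann_remainder _ _ s0 s1 contrS.
apply: (cbounded_frob _ c measurable_neumann) => U uU.
by have := hc 0%N _ (unitary_adjmx _ uU); rewrite expr0 mul1r.
Qed.

(* Each term is homogeneous of degree [k + 1] in [U^*], so it changes sign when [U] is rotated by
   a phase whose [(k + 1)]-st power is [-1]. *)
Lemma cexp_neumann_term k i j :
  cexp (fun U : MX => iter k (mulmx (adjmx (U : M) *m S)) (adjmx (U : M)) i j) = 0.
Proof.
set f := fun U : MX => _; pose t : R[i] := k.+1.-root (-1).
have tk : t ^+ k.+1 = -1 by rewrite rootCK.
have nt : `|t| = 1.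
  have : `|t| ^+ k.+1 == 1 by rewrite -normrX tk normrN1.
  by rewrite pexpr_eq1 // => /eqP.
have tt : t * t^*%C = 1.
  by have := normCK t; rewrite nt expr1n => /esym.
have Qf : Q f := cbounded_iter k _ cbounded_adjmx i j.
have uW : unitary_mx ((t^*%C)%:M : M) by apply: unitary_scalar; rewrite conjcK.
have fW : (fun U : MX => f ((t^*%C)%:M *m U)) = (fun U => -1 * f U).
  apply/funext => U; rewrite /f mul_scalar_mx adjmxZ conjcK neumann_term_scale.
  by rewrite mxE tk.
have := cexp_lmul _ _ uW Qf; rewrite fW cexpZ // mulN1r => /esym/eqP.
by rewrite -addr_eq0 -mulr2n mulrn_eq0 => /eqP.
Qed.

Lemma mx_integral_neumann : mx_integral P (fun U : MX => neumann S (adjmx (U : M))) = 0.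
Proof.
apply/matrixP => i j; rewrite mx_integralE [RHS]mxE.
have [c c0 hc] := frob_neumann_remainder _ _ s0 s1 contrS.
pose rem n (U : MX) : R[i] :=
  iter n (mulmx (adjmx (U : M) *m S)) (neumann S (adjmx (U : M))) i j.
have Qrem n : Q (rem n) := cbounded_iter n _ cbounded_neumann i j.
have E n : cexp (fun U : MX => neumann S (adjmx (U : M)) i j) = cexp (rem n).
  pose g n (U : MX) : R[i] := iter n (mulmx (adjmx (U : M) *m S)) (adjmx (U : M)) i j.
  have Qg k : Q (g k) := cbounded_iter k _ cbounded_adjmx i j.
  have Qs : Q (fun U => \sum_(k < n) g k U + rem n U).
    by apply: cboundedD => //; apply: (closed_sum _ cbounded_cst cboundedD) => k.
  rewrite (cexp_ae _ (fun U => \sum_(k < n) g k U + rem n U)).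
  - rewrite cexpD //; last exact: (closed_sum _ cbounded_cst cboundedD).
    by rewrite cexp_sum // big1 ?add0r // => k _; apply: cexp_neumann_term.
  - exact: measurable_neumann.
  - exact: Qs.1.
  - move=> U uU _; rewrite (neumann_expand S s s0 s1 contrS _ n (unitary_adjmx _ uU)).
    by rewrite mxE summxE.
(* [frob] controls squared moduli, hence the comparison with [e ^+ 2]. *)
have small e : 0 < e -> exists n, s ^+ n * c <= e ^+ 2.
  move=> e0; have e2 : 0 < e ^+ 2 / c by rewrite divr_gt0 ?exprn_gt0.
  have [n _ hn] : \forall n \near \oo, s ^+ n < e ^+ 2 / c.
    have /cvgr0Pnorm_lt/(_ _ e2) : s ^+ n @[n --> \oo] --> (0 : R).
      by apply: cvg_expr; rewrite ger0_norm.
    by apply: filterS => n; rewrite ger0_norm ?exprn_ge0.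
  by exists n; rewrite -ler_pdivlMr //; apply: ltW; apply: hn => /=.
have key e : 0 < e -> `|complex.Re (cexp (fun U : MX => neumann S (adjmx (U : M)) i j))| <= e
    /\ `|complex.Im (cexp (fun U : MX => neumann S (adjmx (U : M)) i j))| <= e.
  move=> e0; have [n hn] := small e e0; rewrite (E n).
  apply: cexp_le => // [|U uU]; first exact: ltW.
  apply: le_trans (sqnorm_le_frob _ i j) _.
  exact: le_trans (hc n _ (unitary_adjmx _ uU)) hn.
have norm_small (x : R) : (forall e, 0 < e -> `|x| <= e) -> x == 0.
  move=> hx; rewrite -normr_eq0 eq_le normr_ge0 andbT leNgt; apply/negP => x0.
  have := hx (`|x| / 2); rewrite divr_gt0 // => /(_ isT); lra.
by apply/eqP; rewrite eq_complex; apply/andP; split; apply: norm_small => e /key[].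
Qed.

End Neumann.

End HaarExpectation.

(** * The averaged Green block and its boundary values *)

Lemma invmx_swap {F : fieldType} {n : nat} (a b c d : 'M[F]_n) :
  a \in unitmx -> d \in unitmx -> b *m d = a *m c -> invmx a *m b = c *m invmx d.
Proof.
move=> ua ud h; apply: (can_inj (mulKmx ua)); apply: (can_inj (mulmxK ud)).
by rewrite mulKVmx // mulmxA mulmxKV.
Qed.

Section GreenIntegral.
Context {R : realType} {L : nat}.
Variables (T V : nat -> 'M[R[i]]_L) (N : nat).
Hypothesis N_gt0 : (0 < N)%N.
Hypothesis T_unit : forall n, (2 <= n <= N)%N -> T n \in unitmx.
Hypothesis V_sa : forall n, (1 <= n <= N)%N -> adjmx (V n) = V n.
Variable P : probability (MxSpace R L) R.
Hypothesis haarP : is_haar P.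

Local Notation MX := (MxSpace R L).
Local Notation a z := (Ablk T V z N + 'i *: Cblk T V z N).
Local Notation b z := (Bblk T V z N + 'i *: Dblk T V z N).

Lemma measurable_Gfun z : entrywise cmeasurable (fun U : MX => Gfun N_gt0 T V z U).
Proof.
apply: (entrywise_Gfun _ cmeasurable_cst cmeasurableD cmeasurableM).
  exact: cmeasurableV.
exact: measurable_coord.
Qed.

Lemma integral_Gfun z : 0 < complex.Im z ->
  mx_integral P (Gfun N_gt0 T V z) = invmx (a z) *m b z /\
  mx_integral P (fun U => ImMx (Gfun N_gt0 T V z U)) = ImMx (invmx (a z) *m b z).
Proof.
move=> z0; have [s [s0 s1 contr]] := boundary_contraction _ _ _ N_gt0 T_unit V_sa _ z0.
have GE := Gfun_neumann _ _ _ N_gt0 T_unit V_sa _ z0.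
have mG := measurable_Gfun z.
move: (a z) (b z) (_ *m invmx _) contr GE => a b S contr.
set B := S *m b - _; move: B => B GE.
(* [F] agrees with [Gfun] off a null set and is bounded on every unitary, those with eigenvalue 1
   included. Linearity is applied to [F], while [Gfun] only has to be measurable. *)
pose F (U : MX) : 'M[R[i]]_L := invmx a *m b + invmx a *m neumann S (adjmx U) *m B.
have QN := cbounded_neumann _ _ s0 s1 contr.
have QF : entrywise cbounded F.
  apply: (entrywiseD _ cboundedD); first exact: (entrywise_cst _ cbounded_cst).
  apply: (entrywiseM _ cbounded_cst cboundedD cboundedM);
    last exact: (entrywise_cst _ cbounded_cst).
  apply: (entrywiseM _ cbounded_cst cboundedD cboundedM) => //.
  exact: (entrywise_cst _ cbounded_cst).
have mF : entrywise cmeasurable F by move=> i j; have [] := QF i j.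
have intF : mx_integral P F = invmx a *m b.
  rewrite mx_integral_affine // (mx_integral_neumann _ haarP _ _ s0 s1 contr).
  by rewrite mulmx0 mul0mx addr0.
split; first by rewrite (mx_integral_ae _ haarP _ _ mG mF GE).
have intI := mx_integral_ImMx _ haarP _ QF; rewrite intF in intI; rewrite -intI.
have mI (H : MX -> 'M[R[i]]_L) : entrywise cmeasurable H ->
    entrywise cmeasurable (fun U => ImMx (H U)).
  move=> mH; apply: (entrywiseZ _ cmeasurableM); first exact: cmeasurable_cst.
  apply: (entrywiseB _ cmeasurable_cst cmeasurableD cmeasurableM) => //.
  exact: (entrywise_adjmx _ cmeasurableJ).
apply: (mx_integral_ae _ haarP _ _ (mI _ mG) (mI _ mF)) => U uU U1.
by rewrite (GE U uU U1).
Qed.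

Lemma right_continuous_boundary E :
  entrywise right_continuous0
    (fun eta : R => ImMx (invmx (a (E +i* eta)) *m b (E +i* eta))).
Proof.
have Qz : right_continuous0 (fun eta : R => E +i* eta).
  by split; [apply: cvg_cst | apply: cvg_at_right_filter; apply: cvg_id].
have Qt := entrywise_transfer _ right_continuous0_cst right_continuous0D
  right_continuous0M T V _ N Qz.
have cst (c : R[i]) : right_continuous0 (fun=> c) := right_continuous0_cst c.
have sub (F G : R -> 'M[R[i]]_L) : entrywise right_continuous0 F ->
    entrywise right_continuous0 G -> entrywise right_continuous0 (fun x => F x + 'i *: G x).
  move=> QF QG; apply: (entrywiseD _ right_continuous0D) => //.
  exact: (entrywiseZ _ right_continuous0M).
have Qa : entrywise right_continuous0 (fun eta : R => a (E +i* eta)).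
  by apply: sub => i j; under eq_fun do rewrite !mxE; apply: Qt.
have Qb : entrywise right_continuous0 (fun eta : R => b (E +i* eta)).
  by apply: sub => i j; under eq_fun do rewrite !mxE; apply: Qt.
have Qab : entrywise right_continuous0
    (fun eta : R => invmx (a (E +i* eta)) *m b (E +i* eta)).
  apply: (entrywiseM _ cst right_continuous0D right_continuous0M) => //.
  apply: (entrywise_inv _ cst right_continuous0D right_continuous0M) => //.
  (* Continuity of the reciprocal needs the determinant of [a] to be nonzero at [eta = 0], which the
     Wronskian at real energy provides. *)
  apply: right_continuous0V; last exact: (closed_det _ cst right_continuous0D right_continuous0M).
  rewrite -unitfE -unitmxE.
  exact: (unit_wronskian _ _ _ two_i_neq0 (boundary_real_wronskian T V N T_unit V_sa E)).
apply: (entrywiseZ _ right_continuous0M) => //.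
apply: (entrywiseB _ cst right_continuous0D right_continuous0M) => //.
exact: (entrywise_adjmx _ right_continuous0J).
Qed.

End GreenIntegral.

Theorem theorem2 (R : realType) (L N : nat) (hN : (0 < N)%N)
  (T V : nat -> 'M[R[i]]_L)
  (hT : forall n : nat, (2 <= n <= N)%N -> T n \in unitmx)
  (hV : forall n : nat, (1 <= n <= N)%N -> adjmx (V n) = V n)
  (P : probability (MxSpace R L) R) (hP : is_haar P) :
  (forall z : R[i], 0 < complex.Im z ->
     mx_integral P (Gfun hN T V z)
       = invmx (Ablk T V z N + 'i *: Cblk T V z N) *m (Bblk T V z N + 'i *: Dblk T V z N)
     /\
     mx_integral P (Gfun hN T V z)
       = (adjmx (Bblk T V (Num.conj z) N) + 'i *: adjmx (Dblk T V (Num.conj z) N))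
         *m invmx (adjmx (Ablk T V (Num.conj z) N) + 'i *: adjmx (Cblk T V (Num.conj z) N)))
  /\
  (forall (E : R) (i j : 'I_L),
     let lim_mx := invmx (adjmx (Ablk T V E%:C N) *m Ablk T V E%:C N
                          + adjmx (Cblk T V E%:C N) *m Cblk T V E%:C N) in
     complex.Re (mx_integral P (fun U => ImMx (Gfun hN T V (E +i* eta) U)) i j)
       @[eta --> 0^'+] --> complex.Re (lim_mx i j)
     /\
     complex.Im (mx_integral P (fun U => ImMx (Gfun hN T V (E +i* eta) U)) i j)
       @[eta --> 0^'+] --> complex.Im (lim_mx i j)).
Proof.
move=> /=; split=> [z z0|E i j].
  have [intG _] := integral_Gfun T V N hN hT hV P hP z z0.
  split; first exact: intG.
  rewrite intG; apply: invmx_swap.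
  - exact: boundary_unit.
  - exact: boundary_adj_unit.
  - exact: boundary_swap.
have [cRe cIm] := right_continuous_boundary T V N hT hV E i j.
rewrite -(ImMx_boundary_real T V N hT hV E).
(* The closed form equals the integral for [eta > 0], which is all that a right limit sees; at
   [eta = 0] only the closed form is evaluated. *)
have near0 : \forall eta \near 0^'+,
    mx_integral P (fun U => ImMx (Gfun hN T V (E +i* eta) U))
    = ImMx (invmx (Ablk T V (E +i* eta) N + 'i *: Cblk T V (E +i* eta) N)
        *m (Bblk T V (E +i* eta) N + 'i *: Dblk T V (E +i* eta) N)).
  near=> eta; apply: (integral_Gfun T V N hN hT hV P hP _ _).2 => /=.
  by near: eta; apply: nbhs_right_gt.
split; [move: cRe | move: cIm]; apply: cvg_trans; apply: near_eq_cvg;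
  by apply: filterS near0 => eta ->.
Unshelve.
all: by end_near.
Qed.
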